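(* Let $\gamma(\mathbf{x},\mathbf{y})=\tilde\gamma(|\mathbf{y}-\mathbf{x}|)$ be a kernel satisfying the kernel assumptions (K1) and (K2) stated in the context, and let $A=(a_{i,j})$ be the associated $(m+n)\times(m+n)$ stiffness matrix with entries $$a_{i,j}=-\int_{\Omega_h}\mathcal{L}\widehat\phi_j(\mathbf{x})\,\widehat\phi_i(\mathbf{x})\,d\mathbf{x},\qquad i,j=1,\dots,m+n.$$ Then there exists a constant $C$, independent of the mesh parameter $h$, such that $$\mathrm{cond}_2(A)\le C.$$
   Context: $\Omega\subset\mathbb{R}^d$ is a bounded, open, convex domain with Lipschitz boundary, $\delta>0$ is a constant (the horizon), and $\Omega_I=\{\mathbf{y}\in\mathbb{R}^d\setminus\Omega:\ \mathrm{dist}(\mathbf{y},\partial\Omega)<\delta\}$. For $\mathbf{x}\in\Omega\cup\Omega_I$ and $r>0$, $B_r(\mathbf{x})=\{\mathbf{y}\in\Omega\cup\Omega_I:\ |\mathbf{y}-\mathbf{x}|\le r\}$. The nonlocal operator is $\mathcal{L}u(\mathbf{x})=\int_{\mathbb{R}^d}(u(\mathbf{y})-u(\mathbf{x}))\gamma(\mathbf{x},\mathbf{y})\,d\mathbf{y}$. Kernel assumptions on the nonnegative symmetric kernel $\gamma$: (K1) there is a constant $\gamma_0>0$ such that for all $\mathbf{x}\in\Omega\cup\Omega_I$: $\gamma(\mathbf{x},\mathbf{y})\ge\gamma_0$ for all $\mathbf{y}\in B_{\delta/2}(\mathbf{x})$, and $\gamma(\mathbf{x},\mathbf{y})=0$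 for all $\mathbf{y}\in(\Omega\cup\Omega_I)\setminus B_\delta(\mathbf{x})$; (K2) $\gamma(\mathbf{x},\mathbf{y})=\tilde\gamma(|\mathbf{y}-\mathbf{x}|)\ge0$ and $\int_{\mathbb{R}^d}\tilde\gamma(|\mathbf{z}|)\,d\mathbf{z}=1$. Interactions are limited to distance $\delta$: $\tilde\gamma(r)=0$ for $r>\delta$. The kernel (and $\delta$) is fixed; $C$ may depend on it. Discretization: $\mathcal{T}_h$ is a member of a shape-regular, quasi-uniform family (as $h\to0$) of triangulations of $\Omega\cup\Omega_I$ that simultaneously triangulate $\Omega$, $h$ being the largest element diameter; $\Omega_h=\mathcal{T}_h\cap\overline\Omega$ is the union of the elements triangulating $\Omega$ (contained in $\overline\Omega$ since $\Omega$ is convex). Let $\phi_1,\dots,\phi_{m}$ and $\phi_{m+1},\dots,\phi_{m+n}$ be the continuous piecewise linear nodal basis functions on $\mathcal{T}_h$ associated with the nodes in $\Omega_h\setminus\partial\Omega$ and in $\Omega_h\cap\partial\Omega$, respectively. Put $\widehat\phi_j=\phi_j$ on $\Omega_h$ and $\widehat\phi_j=0$ outside $\Omega_h$. $\mathrm{cond}_2(A)$ is the spectral condition number $\|A\|_2\|A^{-1}\|_2$. *)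

(* Defs.v *)
From HB Require Import structures.
From mathcomp Require Import all_boot all_order all_algebra.
From mathcomp Require Import all_classical all_reals all_analysis.

Set Implicit Arguments.
Unset Strict Implicit.
Unset Printing Implicit Defensive.

Import Order.TTheory GRing.Theory Num.Theory.
Import numFieldNormedType.Exports.

Local Open Scope classical_set_scope.
Local Open Scope ring_scope.

Definition measure_rV_display : measure_display -> measure_display.
Proof. exact. Qed.

Section measurable_rV.
Context {d} {T : sigmaRingType d}.
Variable n : nat.

Let coors : 'I_n -> 'rV[T]_n -> T := fun i x => x ord0 i.

Let rV_set0 : g_sigma_preimage coors set0.
Proof. exact: sigma_algebra0. Qed.

Let rV_setC A : g_sigma_preimage coors A -> g_sigma_preimage coors (~` A).
Proof. exact: sigma_algebraC. Qed.

Let rV_bigcup (F : _^nat) : (forall i, g_sigma_preimage coors (F i)) ->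
  g_sigma_preimage coors (\bigcup_i (F i)).
Proof. exact: sigma_algebra_bigcup. Qed.

(* The product sigma-algebra; over a realType these are the Borel sets. *)
HB.instance Definition _ := @isMeasurable.Build (measure_rV_display d)
  'rV[T]_n (g_sigma_preimage coors) rV_set0 rV_setC rV_bigcup.

End measurable_rV.


Section lebesgue_rV.
Context {R : realType}.

Lemma measurable_coor_rV m (i : 'I_m) :
  measurable_fun [set: 'rV[R]_m] (fun x => x ord0 i).
Proof.
move=> _ Y mY; rewrite setTI; apply: sub_sigma_algebra => /=.
rewrite -bigcup_seq/=; exists i => /=; first by rewrite mem_index_enum.
by exists Y => //; rewrite setTI.
Qed.

Lemma measurable_fun_rV d (T : measurableType d) m (f : T -> 'rV[R]_m) :
  (forall i, measurable_fun [set: T] (fun x => f x ord0 i)) ->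
  measurable_fun [set: T] f.
Proof.
move=> mf.
apply: (@measurability _ _ _ _ _ _
  (\big[setU/set0]_(i < m) preimage_set_system setT
     (fun x : 'rV[R]_m => x ord0 i) measurable)) => //.
move=> _ [C + <-]; rewrite -bigcup_seq => -[i /= _ [A mA <-]].
rewrite setTI; have := mf i measurableT A mA.
by rewrite !setTI.
Qed.

Section cons.
Variable n : nat.

Definition cons_rV (p : measurableTypeR R * 'rV[R]_n) : 'rV[R]_n.+1 :=
  row_mx (const_mx p.1 : 'rV_1) p.2.

Definition uncons_rV (x : 'rV[R]_n.+1) : measurableTypeR R * 'rV[R]_n :=
  (x ord0 ord0, rsubmx (x : 'rV_(1 + n))).

Lemma cons_rVK : cancel cons_rV uncons_rV.
Proof.
move=> [a x]; rewrite /uncons_rV /cons_rV; congr pair; last exact: row_mxKr.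
rewrite (_ : ord0 = lshift n (ord0 : 'I_1)); last exact: val_inj.
by apply: etrans (row_mxEl _ _ _ _) _; rewrite mxE.
Qed.

Lemma measurable_cons_rV : measurable_fun setT cons_rV.
Proof.
apply: measurable_fun_rV => i; rewrite /cons_rV.
case: (split_ordP (i : 'I_(1 + n))) => j ->.
  rewrite [X in measurable_fun _ X](_ : _ = fst); first exact: measurable_fst.
  by apply/funext => x; apply: etrans (row_mxEl _ _ _ _) _; rewrite mxE.
rewrite [X in measurable_fun _ X](_ : _ =
    (fun x : 'rV[R]_n => x ord0 j) \o snd).
  by apply: measurableT_comp => //; exact: measurable_coor_rV.
by apply/funext => x; exact: row_mxEr.
Qed.

Lemma measurable_uncons_rV : measurable_fun setT uncons_rV.
Proof.
apply: measurable_fun_pair; first exact: measurable_coor_rV.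
apply: measurable_fun_rV => i.
rewrite [X in measurable_fun _ X](_ : _ =
  (fun x : 'rV[R]_n.+1 => x ord0 (rshift 1 i : 'I_n.+1))).
  exact: measurable_coor_rV.
by apply/funext => x; rewrite !mxE.
Qed.

HB.instance Definition _ :=
  isMeasurableFun.Build _ _ _ _ cons_rV measurable_cons_rV.

Variable mu : {sigma_finite_measure set 'rV[R]_n -> \bar R}.

Definition lebesgue_cons : set 'rV[R]_n.+1 -> \bar R :=
  pushforward (lebesgue_measure \x mu)%E cons_rV.

Let lebesgue_cons0 : lebesgue_cons set0 = 0%E.
Proof. exact: measure0. Qed.

Let lebesgue_cons_ge0 A : (0 <= lebesgue_cons A)%E.
Proof. exact: measure_ge0. Qed.

Let lebesgue_cons_sigma_additive : semi_sigma_additive lebesgue_cons.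
Proof. exact: (@measure_semi_sigma_additive _ _ _ (pushforward _ cons_rV)). Qed.

HB.instance Definition _ := isMeasure.Build _ _ _ lebesgue_cons
  lebesgue_cons0 lebesgue_cons_ge0 lebesgue_cons_sigma_additive.

Let lebesgue_cons_sigma_finite : sigma_finite setT lebesgue_cons.
Proof.
have /sigma_finiteP[F [TF ndF Foo]] := sigma_finiteT (@lebesgue_measure R).
have /sigma_finiteP[G [TG ndG Goo]] := sigma_finiteT mu.
exists (fun k => uncons_rV @^-1` (F k `*` G k)).
  rewrite -preimage_bigcup; apply/esym/seteqP; split=> // x _.
  have [[k _ Fk] [l _ Gl]] : (\bigcup_k F k) (uncons_rV x).1 /\
    (\bigcup_k G k) (uncons_rV x).2 by rewrite -TF -TG.
  exists (maxn k l) => //; split.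
  - by move: Fk; exact/subsetPset/ndF/leq_maxl.
  - by move: Gl; exact/subsetPset/ndG/leq_maxr.
move=> k; have [mF Fk] := Foo k; have [mG Gk] := Goo k; split.
  rewrite -[X in measurable X]setTI.
  by apply: measurable_uncons_rV => //; exact: measurableX.
rewrite /lebesgue_cons /pushforward -comp_preimage.
rewrite (_ : uncons_rV \o cons_rV = id); last first.
  by apply/funext => x; exact: cons_rVK.
rewrite preimage_id product_measure1E//.
by rewrite lte_mul_pinfty// ge0_fin_numE.
Qed.

HB.instance Definition _ := Measure_isSigmaFinite.Build _ _ _ lebesgue_cons
  lebesgue_cons_sigma_finite.

End cons.

(* The d-fold product of the one-dimensional Lebesgue measure. *)
Fixpoint lebesgue_rV (d : nat) : {sigma_finite_measure set 'rV[R]_d -> \bar R} :=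
  match d with
  | 0 => [the {sigma_finite_measure set 'rV[R]_0 -> \bar R} of
           dirac (0 : 'rV[R]_0)]
  | n.+1 => [the {sigma_finite_measure set 'rV[R]_n.+1 -> \bar R} of
              lebesgue_cons (lebesgue_rV n)]
  end.

End lebesgue_rV.

Section euclidean.
Context {R : realType}.

(* The library norm on matrices is the sup norm.  [enorm] is only used on row
   and column vectors. *)
Definition enorm {m n : nat} (x : 'M[R]_(m, n)) : R :=
  Num.sqrt (\sum_(i < m) \sum_(j < n) x i j ^+ 2).

Definition edot {d : nat} (x y : 'rV[R]_d) : R := \sum_(k < d) x 0 k * y 0 k.

Definition spectral_norm {n : nat} (A : 'M[R]_n) : R :=
  sup [set enorm (A *m x) | x in [set x : 'cV[R]_n | enorm x <= 1]].

(* Meaningful for A \in unitmx only: invmx A is A when A is singular. *)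
Definition cond2 {n : nat} (A : 'M[R]_n) : R :=
  spectral_norm A * spectral_norm (invmx A).

Variable d : nat.
Implicit Types A D : set 'rV[R]_d.

Definition bd D : set 'rV[R]_d := closure D `\` interior D.

Definition setdist (x : 'rV[R]_d) A : R := inf [set enorm (x - y) | y in A].

Definition ediam A : R := sup [set enorm (p.1 - p.2) | p in A `*` A].

Definition inradius A : R :=
  sup [set r | 0 <= r /\ exists c, [set y | enorm (y - c) <= r] `<=` A].

Definition ebounded A : Prop := exists M : R, forall x, A x -> enorm x <= M.

(* Near each boundary point D is the strict subgraph, in the direction of a
   unit vector e, of a Lipschitz function g of the orthogonal projection on the
   hyperplane normal to e. *)
Definition lipschitz_boundary D : Prop :=
  forall p, bd D p ->
  exists (r L : R) (e : 'rV[R]_d) (g : 'rV[R]_d -> R),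
    let proj x := x - edot x e *: e in
    [/\ 0 < r, enorm e = 1,
        forall x y,
          `|g (proj x) - g (proj y)| <= L * enorm (proj x - proj y)
      & forall x, enorm (x - p) < r -> (D x <-> edot x e < g (proj x))].

Definition convex_lipschitz_domain D : Prop :=
  [/\ D !=set0, open D, ebounded D,
      convex_set (D : set (convex_lmodType 'rV[R]_d))
    & lipschitz_boundary D].

End euclidean.

Section nonlocal.
Context {R : realType}.
Variable d : nat.
Implicit Types (Om : set 'rV[R]_d) (delta : R)
  (gamma : 'rV[R]_d -> 'rV[R]_d -> R).

Definition interaction_domain Om delta : set 'rV[R]_d :=
  [set y | ~ Om y /\ setdist y (bd Om) < delta].

Definition extended_domain Om delta : set 'rV[R]_d :=
  Om `|` interaction_domain Om delta.

Definition rel_ball Om delta (r : R) (x : 'rV[R]_d) : set 'rV[R]_d :=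
  [set y | extended_domain Om delta y /\ enorm (y - x) <= r].

Definition kernel_K1 Om delta gamma : Prop :=
  exists gamma0 : R, 0 < gamma0 /\
    forall x, extended_domain Om delta x ->
      (forall y, rel_ball Om delta (delta / 2) x y -> gamma0 <= gamma x y) /\
      (forall y, (extended_domain Om delta `\` rel_ball Om delta delta x) y ->
         gamma x y = 0).

(* Measurability is what makes the normalisation meaningful. *)
Definition kernel_K2 gamma (gammat : R -> R) : Prop :=
  [/\ forall x y, gamma x y = gammat (enorm (y - x)),
      forall r, 0 <= r -> 0 <= gammat r,
      measurable_fun [set: 'rV[R]_d] (fun z => gammat (enorm z))
    & (\int[lebesgue_rV d]_z (gammat (enorm z))%:E = 1)%E].

Definition nonlocal_op gamma (u : 'rV[R]_d -> R) (x : 'rV[R]_d) : R :=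
  \int[lebesgue_rV d]_y ((u y - u x) * gamma x y).

End nonlocal.

(* An element is given by the set of (indices of) its d+1 vertices. *)
Record mesh (R : realType) (d : nat) := Mesh {
  nnodes : nat;
  node : 'I_nnodes -> 'rV[R]_d;
  elements : {set {set 'I_nnodes}}
}.

Section mesh.
Context {R : realType} {d : nat}.
Implicit Type T : mesh R d.

Definition simplex T (K : {set 'I_(nnodes T)}) : set 'rV[R]_d :=
  [set x | exists w : 'I_(nnodes T) -> R,
     [/\ forall i, 0 <= w i, \sum_(i in K) w i = 1
       & x = \sum_(i in K) w i *: node i]].

Definition affinely_independent T (K : {set 'I_(nnodes T)}) : Prop :=
  forall w : 'I_(nnodes T) -> R,
    \sum_(i in K) w i = 0 -> \sum_(i in K) w i *: node i = 0 ->
    forall i, i \in K -> w i = 0.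

Definition conforming_mesh T : Prop :=
  [/\ injective (@node R d T),
      forall K, K \in elements T -> #|K| = d.+1 /\ affinely_independent K,
      finset.cover (elements T) = [set: 'I_(nnodes T)]%SET
    & forall K K', K \in elements T -> K' \in elements T ->
        simplex K `&` simplex K' = simplex (K :&: K')].

Definition mesh_body T (S : {set {set 'I_(nnodes T)}}) : set 'rV[R]_d :=
  [set x | exists2 K, K \in S & simplex K x].

Definition mesh_size T : R :=
  \big[Num.max/0]_(K in elements T) ediam (simplex K).

(* D may have a curved boundary: the elements S form a polytope inscribed in
   closure D, with boundary vertices on the boundary of D, that misses at most
   a boundary layer of D of width h. *)
Definition triangulates T (S : {set {set 'I_(nnodes T)}})
    (D : set 'rV[R]_d) : Prop :=
  [/\ S != finset.set0,
      mesh_body S `<=` closure D,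
      forall i : 'I_(nnodes T), bd (mesh_body S) (node i) -> bd D (node i)
    & forall x, D x -> mesh_body S x \/ setdist x (bd D) <= mesh_size T].

Definition inner_elements T (Om : set 'rV[R]_d) : {set {set 'I_(nnodes T)}} :=
  [set K in elements T | `[< simplex K `<=` closure Om >]]%SET.

Definition Omega_h T (Om : set 'rV[R]_d) : set 'rV[R]_d :=
  mesh_body (inner_elements T Om).

Definition simultaneous_triangulation T (Om : set 'rV[R]_d) (delta : R) : Prop :=
  [/\ conforming_mesh T,
      triangulates (elements T) (extended_domain Om delta)
    & triangulates (inner_elements T Om) Om].

Definition shape_regular (I : Type) (Th : I -> mesh R d) : Prop :=
  exists2 sigma : R, 0 < sigma &
    forall i K, K \in elements (Th i) ->
      ediam (simplex K) <= sigma * inradius (simplex K).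

Definition quasi_uniform (I : Type) (Th : I -> mesh R d) : Prop :=
  exists2 tau : R, 0 < tau &
    forall i K, K \in elements (Th i) ->
      tau * mesh_size (Th i) <= ediam (simplex K).

Definition nodal_basis T (phi : 'I_(nnodes T) -> 'rV[R]_d -> R) : Prop :=
  forall i,
    [/\ {within mesh_body (elements T), continuous (phi i)},
        forall K, K \in elements T ->
          exists (a : 'rV[R]_d) (b : R),
            forall x, simplex K x -> phi i x = edot a x + b
      & forall j, phi i (node j) = (i == j)%:R].

Definition interior_nodes T (Om : set 'rV[R]_d) : {set 'I_(nnodes T)} :=
  [set i | `[< (Omega_h T Om `\` bd Om) (node i) >]]%SET.

Definition boundary_nodes T (Om : set 'rV[R]_d) : {set 'I_(nnodes T)} :=
  [set i | `[< (Omega_h T Om `&` bd Om) (node i) >]]%SET.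

(* The k-th degree of freedom, interior nodes first. *)
Definition dof_node T (Om : set 'rV[R]_d)
    (k : 'I_(#|interior_nodes T Om| + #|boundary_nodes T Om|)) :
    'I_(nnodes T) :=
  match fintype.split k with
  | inl a => enum_val a
  | inr b => enum_val b
  end.

Definition phi_hat T (Om : set 'rV[R]_d)
    (phi : 'I_(nnodes T) -> 'rV[R]_d -> R)
    (k : 'I_(#|interior_nodes T Om| + #|boundary_nodes T Om|)) :
    'rV[R]_d -> R :=
  patch (fun=> 0) (Omega_h T Om) (phi (dof_node k)).

Definition stiffness T (Om : set 'rV[R]_d)
    (gamma : 'rV[R]_d -> 'rV[R]_d -> R)
    (phi : 'I_(nnodes T) -> 'rV[R]_d -> R) :
    'M[R]_(#|interior_nodes T Om| + #|boundary_nodes T Om|) :=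
  \matrix_(i, j) - \int[lebesgue_rV d]_(x in Omega_h T Om)
    (nonlocal_op gamma (phi_hat phi j) x * phi_hat phi i x).

End mesh.

(* Main.v *)
Require Import Defs.
From HB Require Import structures.
From mathcomp Require Import all_boot all_order all_algebra.
From mathcomp Require Import all_classical all_reals all_analysis.
From mathcomp Require Import unstable measurable_realfun ring lra.

Set Implicit Arguments.
Unset Strict Implicit.
Unset Printing Implicit Defensive.

Import Order.TTheory GRing.Theory Num.Theory.
Import numFieldNormedType.Exports.

Local Open Scope classical_set_scope.
Local Open Scope ring_scope.

(** The stiffness matrix is the Gram matrix of the nonlocal energy
    [a(u, v) = 1/2 * \iint (u(y) - u(x)) (v(y) - v(x)) gamma(x, y) dy dx]
    in the basis of truncated nodal functions: the integral that defines an
    entry is symmetrised by exchanging [x] and [y] ([nonlocal_form_energy]).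
    The condition number of a symmetric matrix is therefore at most the ratio
    of the bounds of [a(u, u)] against the squared length of the coefficient
    vector [c] of [u] ([cond2_le]), and these bounds come in two stages.

    The energy is equivalent to the squared L2 norm.  As the kernel has total
    mass one, [(s - t)^2 <= 2 s^2 + 2 t^2] gives [a(u, u) <= 2 |u|^2]
    ([energy_le]).  Conversely, let [u] vanish outside a bounded set, and let
    [z] be a short vector whose first coordinate is bounded away from zero.
    For a fixed [m], translating the set by [2^m z] makes it disjoint from
    itself, so that [|u|^2 <= |u(. + 2^m z) - u|^2 <= 4^m |u(. + z) - u|^2].
    Integrating over a cube of such vectors, on which the kernel is at least
    [gamma0], yields [|u|^2 <= C a(u, u)] with [C] independent of [u]
    ([poincare]); this nonlocal Poincare inequality holds for jumping
    functions, which is why the boundary nodes do no harm.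

    The squared L2 norm is equivalent to [h^d |c|^2] ([mass_equivalence]).
    Each element contains a cube of side comparable to [h], and cubes half as
    large in different elements are disjoint, because two elements meet in a
    subset of a hyperplane.  Comparing volumes, a node belongs to boundedly
    many elements; together with the bound of an affine function by its nodal
    values this gives the upper bound.  For the lower bound, an affine
    function is at least of the order of its largest nodal value throughout a
    smaller cube near a suitable corner of the cube inside the element.

    The factors [h^d] cancel in the quotient.  All volumes in the argument are
    volumes of cubes, so the only facts about Lebesgue measure that it uses
    are translation invariance and the volume of a cube. *)

(** * Lebesgue measure: translations and cubes *)

Section translation1.
Context {R : realType}.
Implicit Type z : R.

Definition translate1 z (x : measurableTypeR R) : measurableTypeR R := x + z.

Lemma measurable_translate1 z : measurable_fun setT (translate1 z).
Proof. exact: measurable_funD. Qed.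

(* Makes the pushforward by the translation a measure. *)
HB.instance Definition _ z :=
  isMeasurableFun.Build _ _ _ _ (translate1 z) (measurable_translate1 z).

Lemma lebesgue_measure_translation z (A : set (measurableTypeR R)) :
  measurable A -> lebesgue_measure (translate1 z @^-1` A) = lebesgue_measure A.
Proof.
move=> mA.
pose m := pushforward (@lebesgue_measure R) (translate1 z).
rewrite -[LHS]/(m A); apply/esym.
have H := @lebesgue_measure_unique R (m : {measure set (measurableTypeR R) -> \bar R}).
apply: (H (measurable_translate1 z)) => // X [[a b]] _ <-.
rewrite /m /pushforward.
rewrite [X in _ = lebesgue_measure X](_ : _ = `]a - z, b - z]%classic); last first.
  by apply/seteqP; split=> x /=; rewrite /translate1 !in_itv/= ltrBlDr lerBrDr.
rewrite !lebesgue_measure_itv/= !lte_fin ltrD2r -!EFinB.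
by case: ifP => // _; congr (_%:E); ring.
Qed.

Lemma ge0_integral_translation1 z (f : measurableTypeR R -> \bar R) :
  measurable_fun setT f -> (forall x, 0 <= f x)%E ->
  (\int[lebesgue_measure]_x f (translate1 z x) = \int[lebesgue_measure]_x f x)%E.
Proof.
move=> mf f0.
pose m := pushforward (@lebesgue_measure R) (translate1 z).
transitivity (\int[m]_x f x)%E; last first.
  by apply: eq_measure_integral => A mA _; exact: lebesgue_measure_translation.
by rewrite /m ge0_integral_pushforward//; exact: measurable_translate1.
Qed.

End translation1.

Section translation.
Context {R : realType}.

Definition translate n (z x : 'rV[R]_n) : 'rV[R]_n := x + z.

Lemma measurable_translate n (z : 'rV[R]_n) : measurable_fun setT (translate z).
Proof.
apply: measurable_fun_rV => i; rewrite /translate; under eq_fun do rewrite mxE.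
by apply: measurable_funD => //; exact: measurable_coor_rV.
Qed.

HB.instance Definition _ n (z : 'rV[R]_n) :=
  isMeasurableFun.Build _ _ _ _ (translate z) (measurable_translate z).

(** By induction on the dimension: a section of the translated set is a
    translate of another section, so the induction hypothesis applies inside
    the integral over the first coordinate, which is then translated. *)
Lemma lebesgue_rV_translation n (z : 'rV[R]_n) (A : set 'rV[R]_n) :
  measurable A -> lebesgue_rV n (translate z @^-1` A) = lebesgue_rV n A.
Proof.
elim: n z A => [|n IH] z A mA.
  congr (lebesgue_rV 0 _); apply/seteqP; split=> x /=;
  by rewrite (_ : translate z x = x)// [LHS]thinmx0 [RHS]thinmx0.
have mcA : measurable (@cons_rV R n @^-1` A).
  by rewrite -[X in measurable X]setTI; exact: measurable_cons_rV.
pose z0 := z ord0 ord0; pose z' := rsubmx (z : 'rV_(1 + n)).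
rewrite /= /lebesgue_cons /pushforward /product_measure1.
have mg : measurable_fun setT (lebesgue_rV n \o xsection (@cons_rV R n @^-1` A)).
  exact: (@measurable_fun_xsection _ _ (measurableTypeR R) _ R (lebesgue_rV n) _ mcA).
rewrite -[RHS](ge0_integral_translation1 z0 mg)//.
apply: eq_integral => a _ /=.
rewrite -[RHS](IH z'); last exact: (measurable_xsection (translate1 z0 a) mcA).
congr (lebesgue_rV n _); apply/seteqP.
have E x : cons_rV (a, x) + z = cons_rV (translate1 z0 a, x + z').
  apply/rowP => k; case: (split_ordP (k : 'I_(1 + n))) => j ->.
    rewrite mxE /cons_rV !(@row_mxEl _ 1 1 n) !mxE/= /translate1; congr (_ + z _ _).
    by apply: val_inj; rewrite /= ord1.
  by rewrite mxE /cons_rV !(@row_mxEr _ 1 1 n) !mxE.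
by split=> x; rewrite /xsection/translate/= !inE/= ?inE/= E.
Qed.

Lemma ge0_integral_translation n (z : 'rV[R]_n) (f : 'rV[R]_n -> \bar R) :
  measurable_fun setT f -> (forall x, 0 <= f x)%E ->
  (\int[lebesgue_rV n]_x f (translate z x) = \int[lebesgue_rV n]_x f x)%E.
Proof.
move=> mf f0.
transitivity (\int[pushforward (lebesgue_rV n) (translate z)]_x f x)%E; last first.
  by apply: eq_measure_integral => A mA _; exact: lebesgue_rV_translation.
by rewrite ge0_integral_pushforward//; exact: measurable_translate.
Qed.

(** Balls for the sup norm, as their volume is elementary. *)
Definition cube n (x : 'rV[R]_n) (r : R) : set 'rV[R]_n :=
  [set y | forall k, `|y 0 k - x 0 k| <= r].

Lemma measurable_cube n (x : 'rV[R]_n) r : measurable (cube x r).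
Proof.
rewrite (_ : cube x r = \bigcap_(k in [set: 'I_n])
   ((fun y : 'rV[R]_n => y 0 k) @^-1` `[x 0 k - r, x 0 k + r]%classic)).
  apply: fin_bigcap_measurable => // k _.
  by rewrite -[X in measurable X]setTI; apply: measurable_coor_rV.
apply/seteqP; split=> y /= h k; first by move=> _; have := h k; rewrite /= in_itv/= ler_distl.
by have := h k I; rewrite /= in_itv/= ler_distl.
Qed.

Lemma lebesgue_rV_cube n (x : 'rV[R]_n) r : 0 <= r ->
  lebesgue_rV n (cube x r) = ((2 * r) ^+ n)%:E.
Proof.
move=> r0; elim: n x => [|n IH] x.
  rewrite /= /dirac indicE expr0 mem_set//; by case.
rewrite /= /lebesgue_cons /pushforward.
pose x' := rsubmx (x : 'rV_(1 + n)).
rewrite (_ : _ @^-1` _ = `[x 0 0 - r, x 0 0 + r]%classic `*` cube x' r); last first.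
  apply/seteqP; split=> -[a y] /=.
    move=> h; split.
      have := h 0; rewrite /= in_itv/= -ler_distl.
      rewrite {1}(_ : 0 = lshift n (ord0 : 'I_1)); last exact: val_inj.
      by rewrite (@row_mxEl _ 1 1 n) !mxE.
    move=> k; have := h (rshift 1 k).
    by rewrite (@row_mxEr _ 1 1 n) !mxE.
  case=> /=; rewrite in_itv/= -ler_distl => h0 h k.
  case: (split_ordP (k : 'I_(1 + n))) => j ->.
    rewrite (@row_mxEl _ 1 1 n) !mxE.
    by rewrite (_ : lshift n j = 0)//; apply: val_inj; rewrite /= ord1.
  by have := h j; rewrite (@row_mxEr _ 1 1 n) !mxE.
have Hp := @product_measure1E _ _ _ _ _ (@lebesgue_measure R) (lebesgue_rV n).
rewrite [LHS]Hp//; last exact: measurable_cube.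
rewrite [in LHS]IH [X in (X * _)%E]lebesgue_measure_itv/= lte_fin.
case: ifPn => [_|].
  by rewrite -EFinD -EFinM exprS; congr (_ * _)%:E; ring.
rewrite -leNgt => h; have -> : r = 0 by lra.
by rewrite mul0e mulr0 exprS mul0r.
Qed.

End translation.

Section euclidean_norm.
Context {R : realType} (d : nat).

Lemma coor_enorm (z : 'rV[R]_d) i : `|z 0 i| <= enorm z.
Proof.
rewrite -(@ler_pXn2r _ 2)// ?nnegrE ?sqrtr_ge0// /enorm sqr_sqrtr; last first.
  by apply: sumr_ge0 => ? _; apply: sumr_ge0 => ? _; exact: sqr_ge0.
rewrite big_ord1 (bigD1 i)//= real_normK ?num_real// lerDl.
by apply: sumr_ge0 => ? _; exact: sqr_ge0.
Qed.

Lemma enorm_le_sum (z : 'rV[R]_d) : enorm z <= \sum_i `|z 0 i|.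
Proof.
have s0 : 0 <= \sum_i `|z 0 i| by apply: sumr_ge0.
rewrite -(@ler_pXn2r _ 2)// ?nnegrE ?sqrtr_ge0// /enorm sqr_sqrtr; last first.
  by apply: sumr_ge0 => ? _; apply: sumr_ge0 => ? _; exact: sqr_ge0.
rewrite big_ord1 expr2 mulr_suml; apply: ler_sum => i _.
rewrite -[_ ^+ 2]ger0_norm ?sqr_ge0// normrX expr2 ler_wpM2l//.
by rewrite (bigD1 i)//= lerDl; apply: sumr_ge0.
Qed.

End euclidean_norm.

(** * The nonlocal energy *)

Section Rintegral_sum.
Context {dT} {T : measurableType dT} {R : realType}.
Variables (m : {measure set T -> \bar R}) (I : Type) (f : I -> T -> R).
Hypothesis fi : forall i, m.-integrable setT (EFin \o f i).

Lemma integrable_sum_EFin (s : seq I) :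
  m.-integrable setT (EFin \o (fun x => \sum_(i <- s) f i x)).
Proof.
rewrite (_ : _ \o _ = (fun x => \sum_(i <- s) (EFin \o f i) x)%E).
  exact: integrable_sum.
by apply/funext => x /=; rewrite sumEFin.
Qed.

Lemma Rintegral_sum (s : seq I) :
  \int[m]_x (\sum_(i <- s) f i x) = \sum_(i <- s) \int[m]_x f i x.
Proof.
elim: s => [|i s IH].
  by rewrite big_nil; under eq_Rintegral do rewrite big_nil; rewrite Rintegral_cst// mul0r.
rewrite big_cons -IH -RintegralD//; last exact: integrable_sum_EFin.
by apply: eq_Rintegral => x _; rewrite big_cons.
Qed.

End Rintegral_sum.

Section energy.
Context {R : realType} (d : nat).
Notation mu := (lebesgue_rV (R := R) d).
Notation P := (mu \x mu)%E.
Variable k : 'rV[R]_d -> R.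
Hypothesis mk : measurable_fun setT k.
Hypothesis k_ge0 : forall z, 0 <= k z.
Hypothesis k_even : forall z, k (- z) = k z.
Hypothesis k_int : (\int[mu]_z (k z)%:E = 1)%E.

Let mfst : measurable_fun setT (@fst 'rV[R]_d 'rV[R]_d).
Proof. exact: measurable_fst. Qed.

Let msnd : measurable_fun setT (@snd 'rV[R]_d 'rV[R]_d).
Proof. exact: measurable_snd. Qed.

Lemma measurable_kernel :
  measurable_fun setT (fun p : 'rV[R]_d * 'rV[R]_d => k (p.2 - p.1)).
Proof.
apply: (measurableT_comp mk); apply: measurable_fun_rV => i.
under eq_fun do rewrite !mxE.
apply: measurable_funB.
  exact: (measurableT_comp (measurable_coor_rV i) msnd).
exact: (measurableT_comp (measurable_coor_rV i) mfst).
Qed.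

Lemma measurable_kernel1 x : measurable_fun setT (fun y : 'rV[R]_d => k (y - x)).
Proof. exact: (measurableT_comp mk (measurable_translate (- x))). Qed.

Lemma kernel_mass x : (\int[mu]_y (k (y - x))%:E = 1)%E.
Proof.
rewrite -[RHS]k_int -[RHS](ge0_integral_translation (- x))//.
exact/measurable_EFinP.
Qed.

Variable E : set 'rV[R]_d.
Hypothesis mE : measurable E.
Hypothesis Efin : (mu E < +oo)%E.

(** A class containing the nodal functions cut off outside the polytope, which
    jump across its boundary; linear combinations stay in it, and so do
    squares. *)
Definition admissible (u : 'rV[R]_d -> R) :=
  [/\ measurable_fun setT u, exists M, forall x, `|u x| <= M
    & forall x, ~ E x -> u x = 0].

Lemma admissible_integrable u : admissible u -> mu.-integrable setT (EFin \o u).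
Proof.
case=> mu_ [M uM] uE.
have -> : u = u \_ E.
  by apply/funext => x; rewrite /patch; case: ifPn => //; rewrite notin_setE => /uE.
rewrite -restrict_EFin; apply/integrable_restrict => //; rewrite setTI.
apply: measurable_bounded_integrable => //.
  exact: measurable_funTS.
by exists M; split; [exact: num_real|move=> N MN x _; exact: le_trans (uM x) (ltW MN)].
Qed.

Definition jump (u : 'rV[R]_d -> R) (p : 'rV[R]_d * 'rV[R]_d) := u p.2 - u p.1.

Lemma measurable_jump u : measurable_fun setT u -> measurable_fun setT (jump u).
Proof.
move=> mu_; apply: measurable_funB.
  exact: (measurableT_comp mu_ msnd).
exact: (measurableT_comp mu_ mfst).
Qed.

(** The integrand of the form before symmetrisation; the kernel mass absorbs
    the integral in the second variable, leaving an integral of [u]. *)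
Lemma integrable_flux u v : admissible u -> admissible v ->
  P.-integrable setT
    (fun p => (jump v p * k (p.2 - p.1) * u p.1)%:E).
Proof.
move=> au [mv [M vM] _]; have iu := admissible_integrable au.
case: au => mu_ _ _.
apply/integrable12ltyP.
  apply/measurable_EFinP; apply: measurable_funM; last first.
    exact: (measurableT_comp mu_ mfst).
  by apply: measurable_funM; [exact: measurable_jump|exact: measurable_kernel].
have M0 : 0 <= M by exact: le_trans (vM 0).
apply: (@le_lt_trans _ _ (\int[mu]_x ((2 * M)%:E * `|(u x)%:E|))%E); last first.
  rewrite ge0_integralZl//; last 2 first.
  - by apply: measurableT_comp => //; exact/measurable_EFinP.
  - by rewrite lee_fin mulr_ge0.
  rewrite lte_mul_pinfty ?lee_fin ?mulr_ge0//.
  by case/integrableP: iu.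
apply: ge0_le_integral => //.
- by move=> x _; apply: integral_ge0.
- apply: (measurable_fun_fubini_tonelli_F (fun p => `|(jump v p * k (p.2 - p.1) * u p.1)%:E|)%E) => //.
  apply: measurableT_comp => //; apply/measurable_EFinP; apply: measurable_funM; last first.
    exact: (measurableT_comp mu_ mfst).
  by apply: measurable_funM; [exact: measurable_jump|exact: measurable_kernel].
- apply: measurable_funeM; apply: measurableT_comp => //; exact/measurable_EFinP.
move=> x _.
rewrite -[leRHS]mule1 -(kernel_mass x) -ge0_integralZl//; last 3 first.
- apply/measurable_EFinP; exact: measurable_kernel1.
- by move=> y _; rewrite lee_fin.
- by rewrite mule_ge0 ?lee_fin ?mulr_ge0.
apply: ge0_le_integral => //.
- apply: measurableT_comp => //; apply/measurable_EFinP; rewrite /jump/=.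
  apply: measurable_funM => //; apply: measurable_funM.
    exact: measurable_funB.
  exact: measurable_kernel1.
- apply: measurable_funeM; apply/measurable_EFinP; exact: measurable_kernel1.
move=> y _; rewrite -EFinM lee_fin !normrM (ger0_norm (k_ge0 _)) /jump/=.
rewrite mulrAC ler_wpM2r// ler_wpM2r// (le_trans (ler_normB _ _))//.
by have := vM x; have := vM y; lra.
Qed.

Lemma integrable_jump_kernel v x : admissible v ->
  mu.-integrable setT (fun y => ((v y - v x) * k (y - x))%:E).
Proof.
case=> mv [M vM] _.
have ik : mu.-integrable setT (EFin \o (fun y => k (y - x))).
  apply/integrableP; split.
    by apply/measurable_EFinP; exact: measurable_kernel1.
  under eq_integral do rewrite /= ger0_norm//.
  by rewrite kernel_mass ltry.
apply: (integrableMr measurableT _ _ ik); first exact: measurable_funB.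
exists (2 * M); split; first exact: num_real.
move=> N MN y _; apply: le_trans (ltW MN); rewrite (le_trans (ler_normB _ _))//.
by have := vM x; have := vM y; lra.
Qed.

Lemma integral_swap (f : 'rV[R]_d * 'rV[R]_d -> \bar R) :
  P.-integrable setT f ->
  P.-integrable setT (f \o swap) /\ (\int[P]_p f (swap p) = \int[P]_p f p)%E.
Proof.
move=> fi; have mf := measurable_int _ fi.
have mfs : measurable_fun setT (f \o @swap 'rV[R]_d 'rV[R]_d).
  exact: (measurableT_comp mf (@measurable_swap _ _ 'rV[R]_d 'rV[R]_d)).
have fis : P.-integrable setT (f \o swap).
  by apply/integrable21ltyP => //; apply/integrable12ltyP.
split=> //.
by rewrite -[LHS]integral21_prod_meas1// -[RHS]integral12_prod_meas1.
Qed.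

Lemma integrable_jumps u v : admissible u -> admissible v ->
  P.-integrable setT (fun p => (jump u p * jump v p * k (p.2 - p.1))%:E).
Proof.
move=> au av; have fi := integrable_flux au av.
have [gi _] := integral_swap fi.
have := integrableN (integrableD measurableT fi gi).
apply: eq_integrable => // -[x y] _ /=.
by rewrite -(k_even (x - y)) opprB /jump/=; congr (_%:E); ring.
Qed.

Definition energy u v :=
  (2^-1 * \int[P]_p (jump u p * jump v p * k (p.2 - p.1)))%R.

(** Exchanging the two variables changes the sign of the jump of [v], so the
    average of the two double integrals has the integrand
    [- 1/2 (jump v) (jump u) k], in which [u] and [v] play the same role. *)
Lemma nonlocal_form_energy (gamma : 'rV[R]_d -> 'rV[R]_d -> R) u v :
  (forall x y, gamma x y = k (y - x)) -> admissible u -> admissible v ->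
  - (\int[mu]_(x in E) (nonlocal_op gamma v x * u x)) = energy u v.
Proof.
move=> gk au av; have fi := integrable_flux au av.
have [gi gf] := integral_swap fi.
have -> : (\int[mu]_(x in E) (nonlocal_op gamma v x * u x)) =
          \int[P]_p (jump v p * k (p.2 - p.1) * u p.1).
  rewrite Rintegral_mkcond /Rintegral -integral12_prod_meas1//.
  congr fine; apply: eq_integral => x _.
  transitivity (nonlocal_op gamma v x * u x)%:E.
    rewrite /patch; case: ifPn => //; rewrite notin_setE => nEx.
    by case: au => _ _ /(_ _ nEx) ->; rewrite mulr0.
  rewrite /nonlocal_op /fubini_F /= /jump/=.
  under eq_Rintegral do rewrite gk.
  have ij := integrable_jump_kernel x av.
  rewrite -RintegralZr//= /Rintegral fineK//.
  apply: integrable_fin_num => //.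
  by under eq_fun do rewrite mulrC EFinM; apply: integrableZl.
rewrite /energy.
set I := Rintegral _ _ _.
have -> : (\int[P]_p (jump u p * jump v p * k (p.2 - p.1))) = - (I + I).
  have -> : I + I = \int[P]_p (jump v p * k (p.2 - p.1) * u p.1
     + jump v (swap p) * k ((swap p).2 - (swap p).1) * u (swap p).1).
    by rewrite RintegralD//; congr (_ + _); rewrite /I /Rintegral -gf.
  rewrite -mulN1r -RintegralZl//; last first.
    have := integrableD measurableT fi gi.
    by apply: eq_integrable.
  apply: eq_Rintegral => -[x y] _ /=.
  by rewrite -(k_even (x - y)) opprB /jump/=; ring.
lra.
Qed.

Lemma energy_sum (I : finType) (c : I -> R) (u : I -> 'rV[R]_d -> R) :
  (forall i, admissible (u i)) ->
  \sum_i \sum_j c i * c j * energy (u i) (u j) =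
  energy (fun x => \sum_i c i * u i x) (fun x => \sum_i c i * u i x).
Proof.
move=> au.
have ij i j := integrable_jumps (au i) (au j).
have iZ i j : P.-integrable setT
    (EFin \o (fun p => c i * c j * (jump (u i) p * jump (u j) p * k (p.2 - p.1)))).
  exact: (integrableZl measurableT (c i * c j) (ij i j)).
have eZ i j : c i * c j * energy (u i) (u j) = 2^-1 *
    \int[P]_p (c i * c j * (jump (u i) p * jump (u j) p * k (p.2 - p.1))).
  by rewrite /energy mulrCA RintegralZl//; exact: ij.
under eq_bigr => i _ do under eq_bigr => j _ do rewrite eZ.
under eq_bigr do rewrite -mulr_sumr -Rintegral_sum//.
rewrite -mulr_sumr -Rintegral_sum//; last by move=> i; exact: integrable_sum_EFin.
rewrite /energy; congr (_ * _); apply: eq_Rintegral => p _.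
have -> : jump (fun x => \sum_i c i * u i x) p = \sum_i c i * jump (u i) p.
  by rewrite /jump -sumrB; apply: eq_bigr => i _; rewrite -mulrBr.
rewrite -mulrA mulr_suml; apply: eq_bigr => i _.
rewrite mulr_suml mulr_sumr; apply: eq_bigr => j _; ring.
Qed.

Lemma admissible_sum (I : finType) (c : I -> R) (u : I -> 'rV[R]_d -> R) :
  (forall i, admissible (u i)) -> admissible (fun x => \sum_i c i * u i x).
Proof.
move=> au; split.
- by apply: measurable_sum => i; apply: measurable_funM => //; have [] := au i.
- have /choice[M uM] : forall i, exists M, forall x, `|u i x| <= M.
    by move=> i; have [] := au i.
  exists (\sum_i `|c i| * M i) => x; apply: le_trans (ler_norm_sum _ _ _) _.
  by apply: ler_sum => i _; rewrite normrM ler_wpM2l.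
- move=> x nEx; rewrite big1// => i _.
  by have [_ _ ->] := au i; rewrite ?mulr0.
Qed.

Lemma admissible_sqr u : admissible u -> admissible (fun x => u x ^+ 2).
Proof.
case=> mu_ [M uM] uE; split; first exact: measurable_funX.
  by exists (M ^+ 2) => x; rewrite normrX lerXn2r// nnegrE// (le_trans _ (uM x)).
by move=> x /uE ->; rewrite expr0n.
Qed.

Lemma sqr_integralE u : admissible u ->
  (\int[mu]_x ((u x) ^+ 2)%:E = (\int[mu]_x (u x ^+ 2))%:E)%E.
Proof.
move=> /admissible_sqr/admissible_integrable iu.
by rewrite /Rintegral fineK//; exact: integrable_fin_num.
Qed.

Lemma energyE u : admissible u ->
  ((2 * energy u u)%:E = \int[P]_p (jump u p ^+ 2 * k (p.2 - p.1))%:E)%E.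
Proof.
move=> au; rewrite /energy mulrA mulfV ?mul1r// /Rintegral fineK; last first.
  by apply: integrable_fin_num => //; exact: integrable_jumps.
by apply: eq_integral => p _; rewrite expr2.
Qed.

Lemma measurable_sqr_kernel (u : 'rV[R]_d * 'rV[R]_d -> R) : measurable_fun setT u ->
  measurable_fun setT (fun p => (u p ^+ 2 * k (p.2 - p.1))%:E).
Proof.
move=> mu_; apply/measurable_EFinP; apply: measurable_funM; last exact: measurable_kernel.
exact: measurable_funX.
Qed.

Lemma kernel_massM a x : 0 <= a -> (\int[mu]_y (a * k (y - x))%:E = a%:E)%E.
Proof.
move=> a0; under eq_integral do rewrite EFinM.
rewrite ge0_integralZl//; first by rewrite kernel_mass mule1.
- by apply/measurable_EFinP; exact: measurable_kernel1.
- by move=> y _; rewrite lee_fin.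
Qed.

Lemma kernel_massM_left a y : 0 <= a -> (\int[mu]_x (a * k (y - x))%:E = a%:E)%E.
Proof.
move=> a0; rewrite -[RHS](kernel_massM y a0).
by apply: eq_integral => x _; rewrite -k_even opprB.
Qed.

(** From [(s - t)^2 <= 2 s^2 + 2 t^2]: in each of the two resulting terms the
    kernel integrates to one in the variable on which [u] does not depend. *)
Lemma energy_le u : admissible u ->
  energy u u <= 2 * \int[mu]_x (u x ^+ 2).
Proof.
move=> au; have [mu_ _ _] := au.
have m1 : measurable_fun setT (fun p : 'rV[R]_d * 'rV[R]_d => u p.1).
  exact: (measurableT_comp mu_ mfst).
have m2 : measurable_fun setT (fun p : 'rV[R]_d * 'rV[R]_d => u p.2).
  exact: (measurableT_comp mu_ msnd).
rewrite -(@ler_pM2l _ 2)// -lee_fin energyE//.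
have pos (f : 'rV[R]_d * 'rV[R]_d -> R) p : (0 <= (f p ^+ 2 * k (p.2 - p.1))%:E)%E.
  by rewrite lee_fin mulr_ge0// sqr_ge0.
have -> : (2 * (2 * \int[mu]_x (u x ^+ 2)))%:E = (\int[P]_p
    (2%:E * (u p.1 ^+ 2 * k (p.2 - p.1))%:E + 2%:E * (u p.2 ^+ 2 * k (p.2 - p.1))%:E))%E.
  rewrite ge0_integralD//; last 4 first.
  - by move=> p _; rewrite mule_ge0// (pos (fun p => u p.1)).
  - by apply: measurable_funeM; exact: measurable_sqr_kernel.
  - by move=> p _; rewrite mule_ge0// (pos (fun p => u p.2)).
  - by apply: measurable_funeM; exact: measurable_sqr_kernel.
  rewrite !ge0_integralZl//; first last.
  - by move=> p _; exact: (pos (fun p => u p.1)).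
  - exact: measurable_sqr_kernel.
  - by move=> p _; exact: (pos (fun p => u p.2)).
  - exact: measurable_sqr_kernel.
  rewrite fubini_tonelli1//; first last.
  - by move=> p; exact: (pos (fun p => u p.1)).
  - exact: measurable_sqr_kernel.
  rewrite fubini_tonelli2//; first last.
  - by move=> p; exact: (pos (fun p => u p.2)).
  - exact: measurable_sqr_kernel.
  rewrite /fubini_F /fubini_G /=.
  under eq_integral do rewrite kernel_massM ?sqr_ge0//.
  under [X in (_ = _ + _ * X)%E]eq_integral do rewrite kernel_massM_left ?sqr_ge0//.
  by rewrite sqr_integralE// -!EFinM -EFinD; congr (_%:E); ring.
apply: ge0_le_integral => //.
- by apply: measurable_sqr_kernel; exact: measurable_jump.
- by apply: emeasurable_funD; apply: measurable_funeM; exact: measurable_sqr_kernel.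
- move=> p _; rewrite -!EFinM -EFinD lee_fin /jump !mulrA -mulrDl ler_wpM2r//.
  by have := sqr_ge0 (u p.1 + u p.2); rewrite sqrrD sqrrB; lra.
Qed.

Definition shift_energy (u : 'rV[R]_d -> R) (z : 'rV[R]_d) : \bar R :=
  (\int[mu]_x ((u (x + z) - u x) ^+ 2)%:E)%E.

Lemma measurable_shift_sqr (u : 'rV[R]_d -> R) (z : 'rV[R]_d) :
  measurable_fun setT u ->
  measurable_fun setT (fun x : 'rV[R]_d => ((u (x + z) - u x) ^+ 2)%:E).
Proof.
move=> mu_; apply/measurable_EFinP/measurable_funX/measurable_funB => //.
exact: (measurableT_comp mu_ (measurable_translate z)).
Qed.

(** The increment by [z + z] is the sum of two translates of the increment
    by [z], whose norms are equal by translation invariance. *)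
Lemma shift_energy_double u z : measurable_fun setT u ->
  (shift_energy u (z + z) <= 4%:E * shift_energy u z)%E.
Proof.
move=> mu_.
have pos y x : (0 <= ((u (x + y) - u x) ^+ 2)%:E)%E by rewrite lee_fin sqr_ge0.
have -> : (4%:E * shift_energy u z = \int[mu]_x
    (2%:E * ((u (x + z + z) - u (x + z)) ^+ 2)%:E + 2%:E * ((u (x + z) - u x) ^+ 2)%:E))%E.
  have ms := measurable_shift_sqr z mu_.
  rewrite ge0_integralD//; first last.
  - exact: measurable_funeM.
  - by move=> x _; rewrite mule_ge0.
  - by apply: measurable_funeM; exact: (measurableT_comp ms (measurable_translate z)).
  - by move=> x _; rewrite mule_ge0.
  rewrite !ge0_integralZl//; last exact: (measurableT_comp ms (measurable_translate z)).
  rewrite (ge0_integral_translation z ms)// -/(shift_energy u z).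
  rewrite -ge0_muleDl ?lee_fin// -EFinD; congr (_%:E * _)%E; lra.
apply: ge0_le_integral => //.
- exact: measurable_shift_sqr.
- have ms := measurable_shift_sqr z mu_.
  apply: emeasurable_funD; apply: measurable_funeM => //.
  exact: (measurableT_comp ms (measurable_translate z)).
move=> x _; rewrite -!EFinM -EFinD lee_fin addrA.
set a := u (x + z + z); set b := u (x + z); set c := u x.
by have := sqr_ge0 ((a - b) - (b - c)); lra.
Qed.

Lemma shift_energy_pow u z m : measurable_fun setT u ->
  (shift_energy u (z *+ 2 ^ m) <= (4 ^+ m)%:E * shift_energy u z)%E.
Proof.
move=> mu_; elim: m => [|m IH]; first by rewrite expn0 expr0 mul1e.
rewrite expnS mul2n -addnn mulrnDr (le_trans (shift_energy_double _ mu_))//.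
rewrite exprS EFinM -muleA lee_pmul2l// lte_fin.
Qed.

Lemma sqr_integral_le_shift u w : admissible u -> (forall x, E x -> ~ E (x + w)) ->
  (\int[mu]_x (u x ^+ 2)%:E <= shift_energy u w)%E.
Proof.
move=> [mu_ _ uE] Ew; apply: ge0_le_integral => //.
- by move=> x _; rewrite lee_fin sqr_ge0.
- by apply/measurable_EFinP/measurable_funX.
- exact: measurable_shift_sqr.
move=> x _; rewrite lee_fin; have [Ex|/uE ->] := pselect (E x).
  by rewrite (uE (x + w)) ?sub0r ?sqrrN//; exact: Ew.
by rewrite expr0n sqr_ge0.
Qed.

(** The substitution [y = x + z] turns the energy into a kernel-weighted mean
    of the increments of [u]. *)
Lemma energy_shift u : admissible u ->
  ((2 * energy u u)%:E = \int[mu]_z ((k z)%:E * shift_energy u z))%E.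
Proof.
move=> au; have [mu_ _ _] := au; rewrite energyE//.
have pos p : (0 <= (jump u p ^+ 2 * k (p.2 - p.1))%:E)%E.
  by rewrite lee_fin mulr_ge0// sqr_ge0.
rewrite fubini_tonelli1//; last by apply: measurable_sqr_kernel; exact: measurable_jump.
rewrite /fubini_F.
transitivity (\int[mu]_x \int[mu]_z ((u (x + z) - u x) ^+ 2 * k z)%:E)%E.
  apply: eq_integral => x _ /=.
  rewrite -[LHS](ge0_integral_translation x)//; last first.
    apply/measurable_EFinP; apply: measurable_funM; last exact: measurable_kernel1.
    by rewrite /jump/=; apply: measurable_funX; exact: measurable_funB.
  by apply: eq_integral => z _; rewrite /translate/jump/= addrK [x + z]addrC.
rewrite (fubini_tonelli (fun p : 'rV[R]_d * 'rV[R]_d => ((u (p.1 + p.2) - u p.1) ^+ 2 * k p.2)%:E))//=; last 2 first.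
- apply/measurable_EFinP; apply: measurable_funM; last exact: (measurableT_comp mk msnd).
  apply/measurable_funX/measurable_funB; last exact: (measurableT_comp mu_ mfst).
  apply: (measurableT_comp mu_); apply: measurable_fun_rV => i.
  under eq_fun do rewrite !mxE.
  apply: measurable_funD.
    exact: (measurableT_comp (measurable_coor_rV i) mfst).
  exact: (measurableT_comp (measurable_coor_rV i) msnd).
- by move=> p; rewrite lee_fin mulr_ge0// sqr_ge0.
apply: eq_integral => z _.
rewrite -ge0_integralZl//; last 3 first.
- exact: measurable_shift_sqr.
- by move=> x _; rewrite lee_fin sqr_ge0.
- by rewrite lee_fin.
by apply: eq_integral => x _; rewrite -EFinM mulrC.
Qed.

(** The number [m] of doublings depends only on the width [L] of the set and
    on the length of the steps [z]; this makes the constant uniform in [u]. *)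
Lemma poincare (gamma0 rho L : R) : (0 < d)%N -> 0 < gamma0 -> 0 < rho ->
  (forall z, enorm z <= rho -> gamma0 <= k z) ->
  (forall x i, E x -> `|x 0 i| <= L) ->
  exists2 c, 0 < c & forall u, admissible u ->
    c * \int[mu]_x (u x ^+ 2) <= energy u u.
Proof.
move=> d0 g0 rho0 kg EL.
pose i0 := Ordinal d0; pose s := rho / (3 * d%:R).
have s0 : 0 < s by rewrite divr_gt0// mulr_gt0// ltr0n.
(* Vectors of [cube z0 s] have length at most rho and first coordinate at least s. *)
pose z0 : 'rV[R]_d := \row_i (if i == i0 then 2 * s else 0).
(* 2^m steps of such a vector leave any set of width 2 L. *)
have [m Lm] : exists m, 2 * L < (2 ^ m)%:R * s.
  have [m hm] : exists m : nat, (2 * L / s) < m%:R.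
    by exists (Num.truncn (2 * L / s)).+1; exact: truncnS_gt.
  exists m; rewrite -ltr_pdivrMr//; apply: lt_le_trans hm _.
  by rewrite ler_nat ltnW// ltn_expl.
have zk z : cube z0 s z -> gamma0 <= k z.
  move=> hz; apply: kg; apply: le_trans (enorm_le_sum z) _.
  have h i : `|z 0 i| <= 3 * s.
    have := hz i; rewrite mxE !ler_norml; case: eqP => _ /andP[h1 h2]; apply/andP; split; lra.
  apply: le_trans (ler_sum _ (fun i _ => h i)) _.
  rewrite sumr_const card_ord /s -mulr_natr.
  by rewrite le_eqVlt; apply/orP; left; apply/eqP; field; rewrite pnatr_eq0 -lt0n.
have zE z : cube z0 s z -> forall x, E x -> ~ E (x + z *+ 2 ^ m).
  move=> hz x Ex Exz.
  have h : s <= z 0 i0 by have := hz i0; rewrite mxE eqxx ler_norml => /andP[? _]; lra.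
  have := EL _ i0 Ex; have := EL _ i0 Exz; rewrite mxE mulmxnE.
  rewrite -mulr_natl => /ler_normlW; have : s * (2 ^ m)%:R <= (2 ^ m)%:R * z 0 i0.
    by rewrite mulrC ler_wpM2l.
  rewrite ler_norml => ? ? /andP[? _]; lra.
exists (gamma0 / (2 * 4 ^+ m) * (2 * s) ^+ d).
  apply: mulr_gt0; last by apply: exprn_gt0; exact: mulr_gt0.
  by apply: divr_gt0 => //; apply: mulr_gt0 => //; exact: exprn_gt0.
move=> u au; have [mu_ _ _] := au.
rewrite -(@ler_pM2l _ 2)// -lee_fin energy_shift//.
set S := \int[mu]_x (u x ^+ 2).
have S0 : 0 <= S by apply: Rintegral_ge0 => x _; exact: sqr_ge0.
have sS z : cube z0 s z -> ((S / 4 ^+ m)%:E <= shift_energy u z)%E.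
  move=> hz; rewrite -(@lee_pmul2l _ (4 ^+ m)%:E)// ?lte_fin ?exprn_gt0//.
  apply: le_trans (shift_energy_pow z m mu_).
  rewrite -EFinM mulrC divfK ?expf_neq0//.
  by rewrite -sqr_integralE//; apply: sqr_integral_le_shift => //; exact: zE.
have se0 z : (0 <= shift_energy u z)%E.
  by apply: integral_ge0 => x _; rewrite lee_fin sqr_ge0.
have mse : measurable_fun setT (fun z => (k z)%:E * shift_energy u z)%E.
  apply: emeasurable_funM; first exact/measurable_EFinP.
  apply: (measurable_fun_fubini_tonelli_G (fun p : 'rV[R]_d * 'rV[R]_d => ((u (p.1 + p.2) - u p.1) ^+ 2)%:E)).
  - apply/measurable_EFinP.
    apply/measurable_funX/measurable_funB; last exact: (measurableT_comp mu_ mfst).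
    apply: (measurableT_comp mu_); apply: measurable_fun_rV => i.
    under eq_fun do rewrite !mxE.
    apply: measurable_funD.
      exact: (measurableT_comp (measurable_coor_rV i) mfst).
    exact: (measurableT_comp (measurable_coor_rV i) msnd).
  - by move=> p; rewrite lee_fin sqr_ge0.
apply: (@le_trans _ _ (\int[mu]_(z in cube z0 s) ((k z)%:E * shift_energy u z)))%E; last first.
  apply: ge0_subset_integral => //; first exact: measurable_cube.
  by move=> z _; rewrite mule_ge0// lee_fin.
apply: (@le_trans _ _ (\int[mu]_(z in cube z0 s) (gamma0 * (S / 4 ^+ m))%:E))%E.
  rewrite integral_cst; last exact: measurable_cube.
  rewrite [X in (_ * X)%E](lebesgue_rV_cube z0 (ltW s0)).
  rewrite -EFinM lee_fin le_eqVlt; apply/orP; left; apply/eqP; field.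
  by rewrite expf_neq0.
apply: ge0_le_integral => //.
- exact: measurable_cube.
- by move=> z _; rewrite lee_fin mulr_ge0 ?divr_ge0 ?exprn_ge0// ltW.
- exact: measurable_funTS.
- move=> z hz; rewrite EFinM; apply: lee_pmul => //.
  + by rewrite lee_fin ltW.
  + by rewrite lee_fin divr_ge0// exprn_ge0.
  + by rewrite lee_fin zk.
  + exact: sS.
Qed.

End energy.

(** * Affine functions on simplices *)

Section affine.
Context {R : realType} (d : nat).
Implicit Types (a x y : 'rV[R]_d).

Lemma edotDr a x y : edot a (x + y) = edot a x + edot a y.
Proof. by rewrite /edot -big_split; apply: eq_bigr => k _; rewrite mxE mulrDr. Qed.

Lemma edotZr a c x : edot a (c *: x) = c * edot a x.
Proof. by rewrite /edot mulr_sumr; apply: eq_bigr => k _; rewrite mxE mulrCA. Qed.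

Lemma edot0r a : edot a 0 = 0.
Proof. by rewrite /edot big1// => k _; rewrite mxE mulr0. Qed.

Lemma edot_sumr (J : finType) (P : pred J) a (F : J -> 'rV[R]_d) :
  edot a (\sum_(j | P j) F j) = \sum_(j | P j) edot a (F j).
Proof.
exact: (big_morph (edot a) (edotDr a) (edot0r a)).
Qed.

Definition affine_on (D : set 'rV[R]_d) (f : 'rV[R]_d -> R) :=
  exists (a : 'rV[R]_d) (b : R), forall x, D x -> f x = edot a x + b.

Lemma affine_on_sum (I : finType) D (c : I -> R) (f : I -> 'rV[R]_d -> R) :
  (forall i, affine_on D (f i)) -> affine_on D (fun x => \sum_i c i * f i x).
Proof.
move=> /(_ _)/cid => h.
exists (\sum_i c i *: projT1 (h i)).
have h' i := cid (projT2 (h i)).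
exists (\sum_i c i * projT1 (h' i)) => x Dx.
rewrite {1}/edot -[X in _ = X + _](_ : edot x (\sum_i c i *: projT1 (h i)) = _); last first.
  by apply: eq_bigr => k _; rewrite mulrC.
rewrite edot_sumr -big_split; apply: eq_bigr => i _ /=.
rewrite (projT2 (h' i))// edotZr mulrDr; congr (_ * _ + _).
by apply: eq_bigr => k _; rewrite mulrC.
Qed.

Lemma measurable_edot a : measurable_fun setT (edot a : 'rV[R]_d -> R).
Proof.
apply: measurable_sum => k; apply: measurable_funM => //; exact: measurable_coor_rV.
Qed.

Lemma measurable_affine a b : measurable_fun setT (fun x : 'rV[R]_d => edot a x + b).
Proof. by apply: measurable_funD => //; exact: measurable_edot. Qed.

End affine.

Section simplex.
Context {R : realType} (d : nat) (T : mesh R d).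
Implicit Types (K J : {set 'I_(nnodes T)}) (i j : 'I_(nnodes T)).

Lemma simplex_vertex K i : i \in K -> simplex K (node i).
Proof.
move=> iK; exists (fun j => (j == i)%:R); split=> [j||].
- by rewrite ler0n.
- by rewrite (bigD1 i)//= eqxx big1 ?addr0// => j /andP[_ /negbTE->].
- rewrite (bigD1 i)//= eqxx scale1r big1 ?addr0// => j /andP[_ /negbTE->].
  by rewrite scale0r.
Qed.

Lemma affine_combination (a : 'rV[R]_d) b K (w : 'I_(nnodes T) -> R) :
  \sum_(i in K) w i = 1 ->
  edot a (\sum_(i in K) w i *: node i) + b = \sum_(i in K) w i * (edot a (node i) + b).
Proof.
move=> w1; rewrite edot_sumr -[b in LHS]mul1r -w1 mulr_suml -big_split.
by apply: eq_bigr => i _ /=; rewrite edotZr mulrDr.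
Qed.

Lemma affine_on_combination K f (w : 'I_(nnodes T) -> R) : affine_on (simplex K) f ->
  (forall i, 0 <= w i) -> \sum_(i in K) w i = 1 ->
  f (\sum_(i in K) w i *: node i) = \sum_(i in K) w i * f (node i).
Proof.
move=> [a [b fab]] w0 w1; rewrite fab; last by exists w.
rewrite affine_combination//; apply: eq_bigr => i iK.
by rewrite fab//; exact: simplex_vertex.
Qed.

(** The value at a point is a convex combination of the nodal values, and the
    variance of these values with respect to the weights is nonnegative. *)
Lemma affine_on_sqr_le K f x : affine_on (simplex K) f -> simplex K x ->
  f x ^+ 2 <= \sum_(i in K) f (node i) ^+ 2.
Proof.
move=> fK [w [w0 w1 ->]]; rewrite affine_on_combination//.
set m := \sum_(i in K) w i * f (node i).
have wle1 i : i \in K -> w i <= 1.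
  by move=> iK; rewrite -w1 (bigD1 i)//= lerDl sumr_ge0.
apply: (@le_trans _ _ (\sum_(i in K) w i * f (node i) ^+ 2)); last first.
  by apply: ler_sum => i iK; rewrite ler_piMl ?sqr_ge0// wle1.
have : 0 <= \sum_(i in K) w i * (f (node i) - m) ^+ 2.
  by apply: sumr_ge0 => i _; rewrite mulr_ge0// sqr_ge0.
have -> : \sum_(i in K) w i * (f (node i) - m) ^+ 2 =
   \sum_(i in K) w i * f (node i) ^+ 2 - 2 * m * m + m ^+ 2.
  rewrite (eq_bigr (fun i => w i * f (node i) ^+ 2 - 2 * m * (w i * f (node i)) + m ^+ 2 * w i)).
    by rewrite big_split sumrB -!mulr_sumr w1 mulr1.
  by move=> i _; ring.
lra.
Qed.

Lemma simplex_coor_bounded K x k : simplex K x ->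
  `|x 0 k| <= \sum_(i in K) `|node i 0 k|.
Proof.
move=> [w [w0 w1 ->]]; rewrite summxE (le_trans (ler_norm_sum _ _ _))//.
apply: ler_sum => i iK; rewrite mxE normrM (ger0_norm (w0 i)) ler_piMl//.
by rewrite -w1 (bigD1 i)//= lerDl sumr_ge0.
Qed.

Lemma enorm_ediam K x y : simplex K x -> simplex K y -> enorm (x - y) <= ediam (simplex K).
Proof.
move=> Kx Ky; apply: ub_le_sup; last by exists (x, y).
exists (\sum_k (\sum_(i in K) `|node i 0 k| + \sum_(i in K) `|node i 0 k|)).
move=> _ [[x' y'] [/= Kx' Ky'] <-]; apply: le_trans (enorm_le_sum _) _.
apply: ler_sum => k _; rewrite !mxE (le_trans (ler_normB _ _))// lerD//;
exact: simplex_coor_bounded.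
Qed.

Lemma ediam_mesh_size K : K \in elements T -> ediam (simplex K) <= mesh_size T.
Proof. by move=> KT; rewrite /mesh_size (bigD1 K)//= le_max lexx. Qed.

Lemma simplex_in_cube K x y : K \in elements T -> simplex K x -> simplex K y ->
  cube x (mesh_size T) y.
Proof.
move=> KT Kx Ky k; rewrite -[y 0 k - _](_ : (y - x) 0 k = _); last by rewrite !mxE.
apply: le_trans (coor_enorm _ _) _.
by apply: le_trans (enorm_ediam Ky Kx) _; exact: ediam_mesh_size.
Qed.

End simplex.

Lemma measurable_sum_in {R : realType} {d} {X : measurableType d} (I : finType) (K : {set I})
    (f : I -> X -> R) : (forall i, measurable_fun setT (f i)) ->
  measurable_fun setT (fun x => \sum_(i in K) f i x).
Proof.
move=> mf; under eq_fun do rewrite big_mkcond/=.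
by apply: measurable_sum => i; case: (i \in K) => //; exact: mf.
Qed.

Section conforming.
Context {R : realType} (d : nat) (T : mesh R d) (phi : 'I_(nnodes T) -> 'rV[R]_d -> R).
Hypothesis conf : conforming_mesh T.
Hypothesis nb : nodal_basis phi.
Implicit Types (K J : {set 'I_(nnodes T)}) (i j : 'I_(nnodes T)).

Lemma phi_affine K i : K \in elements T -> affine_on (simplex K) (phi i).
Proof. by move=> KT; have [_ h _] := nb i; exact: h. Qed.

Lemma phi_node i j : phi i (node j) = (i == j)%:R.
Proof. by have [_ _] := nb i. Qed.

Lemma phi_barycentric K i (w : 'I_(nnodes T) -> R) : K \in elements T ->
  (forall j, 0 <= w j) -> \sum_(j in K) w j = 1 -> i \in K ->
  phi i (\sum_(j in K) w j *: node j) = w i.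
Proof.
move=> KT w0 w1 iK; rewrite (affine_on_combination (phi_affine i KT))//.
rewrite (bigD1 i)//= phi_node eqxx mulr1 big1 ?addr0// => j /andP[_ ji].
by rewrite phi_node eq_sym (negbTE ji) mulr0.
Qed.

(** If a node lay in an element without being one of its vertices, it would be
    a combination of vertices of an element where its own basis function
    vanishes. *)
Lemma node_in_simplex K j : K \in elements T -> simplex K (node j) -> j \in K.
Proof.
move=> KT Kj; have [_ _ cov meet] := conf.
have : j \in finset.cover (elements T) by rewrite cov inE.
move=> /finset.bigcupP[K' K'T jK'].
have : (simplex K `&` simplex K') (node j) by split=> //; exact: simplex_vertex.
rewrite meet// => -[w [w0 w1 wE]].
have [/setIP[]//|jJ] := boolP (j \in K :&: K').
have [a [b phiE]] := phi_affine j K'T.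
have := phi_node j j; rewrite phiE; last exact: simplex_vertex.
rewrite wE affine_combination// big1 => [/eqP|i iJ].
  by rewrite eqxx eq_sym oner_eq0.
rewrite -phiE; last by apply: simplex_vertex; move/setIP: iJ => [].
by rewrite phi_node; case: eqP iJ jJ => [->->//|]; rewrite mulr0.
Qed.

(** On an element the basis functions are the barycentric coordinates; their
    affine extensions describe the element by finitely many equations and
    inequalities.  Measurability follows. *)
Lemma simplexE K : K \in elements T ->
  exists (a : 'I_(nnodes T) -> 'rV[R]_d) (b : 'I_(nnodes T) -> R),
  simplex K = (\bigcap_(i in [set i | i \in K]) [set x : 'rV[R]_d | 0 <= edot (a i) x + b i])
    `&` [set x : 'rV[R]_d | \sum_(i in K) (edot (a i) x + b i) = 1]
    `&` \bigcap_(k in setT) [set x : 'rV[R]_d | x 0 k = \sum_(i in K) (edot (a i) x + b i) * node i 0 k].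
Proof.
move=> KT.
have /choice[a] : forall i, exists a : 'rV[R]_d, exists b : R,
    forall x, simplex K x -> phi i x = edot a x + b.
  by move=> i; exact: phi_affine.
move=> /choice[b ab]; exists a, b; apply/seteqP; split=> x.
  move=> Kx; have [w [w0 w1 xE]] := Kx.
  have l i : i \in K -> edot (a i) x + b i = w i.
    by move=> iK; rewrite -ab// xE phi_barycentric.
  split; first split.
  - by move=> i /= iK; rewrite l.
  - by rewrite /= -[RHS]w1; apply: eq_bigr => i iK; rewrite l.
  - move=> k _ /=; rewrite {1}xE summxE; apply: eq_bigr => i iK.
    by rewrite l// mxE.
move=> [[/= l0 l1] lx].
exists (fun i => if i \in K then edot (a i) x + b i else 0); split.
- by move=> i; case: ifPn => // iK; exact: l0.
- by rewrite -[RHS]l1; apply: eq_bigr => i ->.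
- apply/rowP => k; rewrite [LHS]lx// summxE; apply: eq_bigr => i iK.
  by rewrite iK mxE.
Qed.

Lemma measurable_simplex K : K \in elements T -> measurable (simplex K).
Proof.
move=> KT; have [a [b ->]] := simplexE KT.
have ml i : measurable_fun setT (fun x : 'rV[R]_d => edot (a i) x + b i).
  exact: measurable_affine.
apply: measurableI; first apply: measurableI.
- apply: fin_bigcap_measurable => [|i _].
    exact: finite_finset.
  rewrite (_ : [set x | _] = (fun x : 'rV[R]_d => edot (a i) x + b i) @^-1` `[0, +oo[%classic).
    by rewrite -[X in measurable X]setTI; apply: ml.
  by apply/seteqP; split=> x /=; rewrite in_itv/= andbT.
- rewrite (_ : [set x | _] = (fun x : 'rV[R]_d => \sum_(i in K) (edot (a i) x + b i)) @^-1` [set 1]).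
    rewrite -[X in measurable X]setTI; apply: measurable_sum_in => //.
  by apply/seteqP; split.
- apply: fin_bigcap_measurable => // k _.
  rewrite (_ : [set x | _] = (fun x : 'rV[R]_d => x 0 k - \sum_(i in K) (edot (a i) x + b i) * node i 0 k) @^-1` [set 0]).
    rewrite -[X in measurable X]setTI.
    have : measurable_fun setT (fun x : 'rV[R]_d =>
        x 0 k - \sum_(i in K) (edot (a i) x + b i) * node i 0 k).
      apply: measurable_funB; first exact: measurable_coor_rV.
      by apply: measurable_sum_in => i; exact: measurable_funM.
    by apply.
  apply/seteqP; split=> x /=; first by move=> {1}->; rewrite subrr.
  by move/eqP; rewrite subr_eq0 => /eqP.
Qed.

End conforming.

(** * Comparing integrals with sums over cubes *)

Section cubes.
Context {R : realType} (d : nat).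
Notation mu := (lebesgue_rV (R := R) d).

Lemma cubeS (x y : 'rV[R]_d) r s : cube x r y -> cube y s `<=` cube x (r + s).
Proof.
move=> xy z yz k.
rewrite (_ : z 0 k - x 0 k = (y 0 k - x 0 k) + (z 0 k - y 0 k)); last by ring.
by rewrite (le_trans (ler_normD _ _))// lerD.
Qed.

Lemma cube_center (x : 'rV[R]_d) r : 0 <= r -> cube x r x.
Proof. by move=> r0 k; rewrite subrr normr0. Qed.

Lemma affine_cube_eq0 (a x : 'rV[R]_d) b r : 0 < r ->
  (forall y, cube x r y -> edot a y + b = 0) -> a = 0 /\ b = 0.
Proof.
move=> r0 h; have hx := h x (cube_center x (ltW r0)).
have a0 : a = 0.
  apply/rowP => k; rewrite mxE.
  have : cube x r (x + r *: delta_mx 0 k).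
    move=> j; rewrite !mxE addrAC subrr add0r eqxx/= normrM (ger0_norm (ltW r0)).
    by rewrite ger0_norm ?ler0n// ler_piMr ?(ltW r0)// lern1; case: (_ == _).
  move=> /h; rewrite edotDr edotZr.
  have -> : edot a (delta_mx 0 k) = a 0 k.
    rewrite /edot (bigD1 k)//= mxE !eqxx mulr1 big1 ?addr0// => j jk.
    by rewrite mxE (negbTE jk) andbF mulr0.
  move=> e; have : r * a 0 k = 0 by lra.
  by move/eqP; rewrite mulf_eq0 gt_eqF//= => /eqP.
split=> //; move: hx; rewrite a0 /edot big1 ?add0r// => k _.
by rewrite mxE mul0r.
Qed.

Lemma measurable_step (I : finType) (S : {set I}) (A : I -> set 'rV[R]_d) (c : I -> R) :
  (forall i, i \in S -> measurable (A i)) ->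
  measurable_fun setT (fun x => (\sum_(i in S) c i * \1_(A i) x)%:E).
Proof.
move=> mA; apply/measurable_EFinP; under eq_fun do rewrite big_mkcond/=.
apply: measurable_sum => i; case: (boolP (i \in S)) => iS; last exact: measurable_cst.
apply: measurable_funM => //.
by apply: measurable_indic; exact: mA.
Qed.

Lemma step_ge0 (I : finType) (S : {set I}) (A : I -> set 'rV[R]_d) (c : I -> R) x :
  (forall i, 0 <= c i) -> 0 <= \sum_(i in S) c i * \1_(A i) x.
Proof. by move=> c0; apply: sumr_ge0 => i _; rewrite mulr_ge0// indicE ler0n. Qed.

Lemma integral_step (I : finType) (S : {set I}) (A : I -> set 'rV[R]_d) (c : I -> R) :
  (forall i, i \in S -> measurable (A i)) -> (forall i, 0 <= c i) ->
  (\int[mu]_x (\sum_(i in S) c i * \1_(A i) x)%:E = \sum_(i in S) (c i)%:E * mu (A i))%E.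
Proof.
move=> mA c0.
rewrite (_ : (fun x => _) = (fun x => \sum_i (if i \in S then (c i)%:E * (\1_(A i) x)%:E else 0))%E); last first.
  apply/funext => x; rewrite -sumEFin big_mkcond/=; apply: eq_bigr => i _.
  by case: ifP => // _; rewrite EFinM.
rewrite ge0_integral_sum//; first last.
- move=> i x _; case: ifPn => // _.
  by rewrite -EFinM lee_fin mulr_ge0// indicE ler0n.
- move=> i; case: (boolP (i \in S)) => iS //; apply: measurable_funeM; apply/measurable_EFinP.
  by apply: measurable_indic; exact: mA.
rewrite [RHS]big_mkcond; apply: eq_bigr => i _.
case: ifPn => iS; last by rewrite integral0.
rewrite ge0_integralZl//; first last.
- by rewrite lee_fin.
- by apply/measurable_EFinP; apply: measurable_indic; exact: mA.
by rewrite integral_indic ?setIT//; exact: mA.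
Qed.

Lemma sum_cubes_le_integral (I : finType) (S : {set I}) (z : I -> 'rV[R]_d) (r : R)
    (c : I -> R) (f : 'rV[R]_d -> R) : 0 <= r ->
  (forall i j, i \in S -> j \in S -> i != j -> cube (z i) r `&` cube (z j) r = set0) ->
  measurable_fun setT f -> (forall x, 0 <= f x) -> (forall i, 0 <= c i) ->
  (forall i x, i \in S -> cube (z i) r x -> c i <= f x) ->
  (((2 * r) ^+ d * \sum_(i in S) c i)%:E <= \int[mu]_x (f x)%:E)%E.
Proof.
move=> r0 dis mf f0 c0 cf.
have mQ i : i \in S -> measurable (cube (z i) r) by move=> _; exact: measurable_cube.
have -> : ((2 * r) ^+ d * \sum_(i in S) c i)%:E =
  (\int[mu]_x (\sum_(i in S) c i * \1_(cube (z i) r) x)%:E)%E.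
  rewrite integral_step// mulr_sumr -sumEFin; apply: eq_bigr => i iS.
  by rewrite lebesgue_rV_cube// -EFinM mulrC.
apply: ge0_le_integral => //.
- by move=> x _; rewrite lee_fin step_ge0.
- exact: measurable_step.
- exact/measurable_EFinP.
move=> x _; rewrite lee_fin.
have [[i iS ix]|nx] := pselect (exists2 i, i \in S & cube (z i) r x).
  rewrite (bigD1 i)//= big1 => [|j /andP[jS ji]].
    by rewrite addr0 indicE mem_set// mulr1; exact: cf.
  rewrite indicE memNset ?mulr0// => jx.
  have := dis j i jS iS ji; rewrite -subset0 => /(_ x); by apply.
rewrite big1// => i iS; rewrite indicE memNset ?mulr0// => ix; apply: nx; by exists i.
Qed.

Lemma integral_le_sum_cover (I : finType) (S : {set I}) (A : I -> set 'rV[R]_d) (m : R)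
    (c : I -> R) (f : 'rV[R]_d -> R) :
  (forall i, i \in S -> measurable (A i)) ->
  (forall i, i \in S -> (mu (A i) <= m%:E)%E) ->
  measurable_fun setT f -> (forall x, 0 <= f x) -> (forall i, 0 <= c i) ->
  (forall x, f x != 0 -> exists i, [/\ i \in S, A i x & f x <= c i]) ->
  (\int[mu]_x (f x)%:E <= (m * \sum_(i in S) c i)%:E)%E.
Proof.
move=> mA Am mf f0 c0 fc.
apply: (@le_trans _ _ (\int[mu]_x (\sum_(i in S) c i * \1_(A i) x)%:E)%E).
  apply: ge0_le_integral => //.
  - by move=> x _; rewrite lee_fin.
  - exact/measurable_EFinP.
  - exact: measurable_step.
  move=> x _; rewrite lee_fin.
  have [->|/fc[i [iS ix fxc]]] := eqVneq (f x) 0.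
    exact: step_ge0.
  rewrite (bigD1 i)//= indicE mem_set// mulr1 (le_trans fxc)// lerDl.
  by apply: sumr_ge0 => j _; rewrite mulr_ge0// ler0n.
rewrite integral_step// mulr_sumr -sumEFin; apply: lee_sum => i iS.
by rewrite mulrC EFinM lee_wpmul2l ?lee_fin//; exact: Am.
Qed.

(** Move from the centre towards the corner of the cube at which [|a.x + b|]
    is largest.  With [m = |a.z + b|] and [A] the sum of the [|a_k|], the
    function is at most [m + h A] on the cube of radius [h], and at least
    [m + (r/2) A] within [r/4] of the point at three quarters of the way. *)
Lemma affine_cube_sqr_le (a z : 'rV[R]_d) (b r h : R) : 0 < r -> r <= h ->
  exists p, cube p (r / 4) `<=` cube z r /\
    forall x y, cube p (r / 4) x -> cube z h y ->
      (edot a y + b) ^+ 2 <= (2 * h / r) ^+ 2 * (edot a x + b) ^+ 2.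
Proof.
move=> r0 rh.
pose m := edot a z + b.
(* Unlike Num.sg, this sign is never zero, so that sg t * sg t = 1. *)
pose sg (t : R) : R := if 0 <= t then 1 else -1.
have sgM t : sg t * t = `|t|.
  by rewrite /sg; case: ifPn => [?|]; [rewrite mul1r ger0_norm|rewrite -ltNge mulN1r => ?; rewrite ltr0_norm].
have sgn t : `|sg t| = 1 by rewrite /sg; case: ifPn; rewrite ?normrN1 ?normr1.
have sg2 t : sg t * sg t = 1 by rewrite /sg; case: ifPn => _; ring.
pose p : 'rV[R]_d := \row_k (z 0 k + 3 / 4 * r * (sg m * sg (a 0 k))).
pose A := \sum_k `|a 0 k|.
have A0 : 0 <= A by apply: sumr_ge0.
have E y : edot a y + b = m + \sum_k a 0 k * (y 0 k - z 0 k).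
  rewrite /m addrAC; congr (_ + b); rewrite /edot -big_split/=.
  by apply: eq_bigr => k _; ring.
exists p; split.
  move=> x hx k; have := hx k; rewrite mxE.
  have : `|3 / 4 * r * (sg m * sg (a 0 k))| <= 3 / 4 * r.
    have q0 : 0 <= 3 / 4 * r by lra.
    by rewrite normrM (ger0_norm q0) normrM !sgn !mulr1.
  rewrite !ler_norml => /andP[? ?] /andP[? ?]; apply/andP; split; lra.
move=> x y hx hy.
have up : `|edot a y + b| <= `|m| + h * A.
  rewrite E (le_trans (ler_normD _ _))// lerD2l (le_trans (ler_norm_sum _ _ _))//.
  rewrite mulr_sumr; apply: ler_sum => k _; rewrite normrM mulrC ler_wpM2r//; exact: hy.
have lo : `|m| + r / 2 * A <= `|edot a x + b|.
  apply: le_trans (_ : sg m * (edot a x + b) <= _); last first.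
    by apply: le_trans (ler_norm _) _; rewrite normrM sgn mul1r.
  rewrite E mulrDr sgM lerD2l !mulr_sumr; apply: ler_sum => k _.
  have := hx k; rewrite mxE.
  set q := sg m * sg (a 0 k); set t := x 0 k.
  have -> : t - (z 0 k + 3 / 4 * r * q) = (t - z 0 k) - 3 / 4 * r * q by ring.
  move: (t - z 0 k) => {}t ht.
  have -> : sg m * (a 0 k * t) = `|a 0 k| * (q * t).
    by rewrite -sgM /q; transitivity (sg m * (sg (a 0 k) * sg (a 0 k)) * a 0 k * t); [rewrite sg2|]; ring.
  rewrite mulrC ler_wpM2l//.
  have q2 : q * q = 1 by rewrite /q mulrACA !sg2 mulr1.
  have : `|q * (t - 3 / 4 * r * q)| <= r / 4 by rewrite normrM /q normrM !sgn !mul1r.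
  rewrite mulrBr (_ : q * (3 / 4 * r * q) = 3 / 4 * r * (q * q)); last by ring.
  by rewrite q2 ler_norml => /andP[? _]; lra.
have hr : 1 <= h / r by rewrite ler_pdivlMr// mul1r.
have key : `|edot a y + b| <= (2 * h / r) * `|edot a x + b|.
  apply: le_trans up _; apply: le_trans (_ : (2 * h / r) * (`|m| + r / 2 * A) <= _); last first.
    by rewrite ler_wpM2l//; lra.
  rewrite mulrDr lerD//.
    by rewrite ler_peMl//; lra.
  by rewrite le_eqVlt; apply/orP; left; apply/eqP; field; rewrite gt_eqF.
rewrite -exprMn -[leLHS]real_normK ?num_real// -[leRHS]real_normK ?num_real//.
rewrite lerXn2r ?nnegrE// [leRHS]normrM [X in _ <= X * _]ger0_norm//; lra.
Qed.

End cubes.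

(** * Cubes inside the elements *)

Section element_cubes.
Context {R : realType} (d : nat) (T : mesh R d).
Hypothesis d_gt0 : (0 < d)%N.
Hypothesis conf : conforming_mesh T.
Implicit Types (K J : {set 'I_(nnodes T)}) (i j : 'I_(nnodes T)).

(** The conditions on [(a, b)] form at most [d] homogeneous linear equations in
    [d + 1] unknowns. *)
Lemma few_points_hyperplane J : (#|J| <= d)%N ->
  exists (a : 'rV[R]_d) (b : R), ~ (a = 0 /\ b = 0) /\
    forall x, simplex J x -> edot a x + b = 0.
Proof.
move=> Jd.
pose M : 'M[R]_(d + 1, #|J|) := col_mx (\matrix_(k, l) node (enum_val l) 0 k) (const_mx 1).
have [[v [vM v0]]|nov] := pselect (exists v : 'rV_(d + 1), v *m M = 0 /\ v <> 0).
  exists (lsubmx v), (rsubmx v 0 0); split.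
    move=> [a0 b0]; apply: v0; rewrite -[v]hsubmxK a0.
    rewrite (_ : rsubmx v = 0) ?row_mx0//.
    by apply/matrixP => i j; rewrite !ord1 b0 mxE.
  have vJ j : j \in J -> edot (lsubmx v) (node j) + rsubmx v 0 0 = 0.
    move=> jJ; have /matrixP/(_ 0 (enum_rank_in jJ j)) := vM.
    rewrite -{1}[v]hsubmxK mul_row_col !mxE big_ord1 !mxE mulr1 => <-.
    congr (_ + _); apply: eq_bigr => k _.
    by rewrite !mxE enum_rankK_in.
  move=> x [w [w0 w1 ->]]; rewrite affine_combination// big1// => j jJ.
  by rewrite vJ// mulr0.
have : row_free M.
  apply: inj_row_free => v vM; apply/eqP/negPn/negP => /eqP v0.
  by apply: nov; exists v.
move=> /eqP rM; have := rank_leq_col M; rewrite rM addn1 => /leq_trans/(_ Jd).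
by rewrite ltnn.
Qed.

(** A common point of the two cubes would be the centre of a cube contained in
    both elements, hence in their common face, hence in a hyperplane. *)
Lemma element_cubes_disjoint K K' (z z' : 'rV[R]_d) r : 0 < r ->
  K \in elements T -> K' \in elements T -> K != K' ->
  cube z (2 * r) `<=` simplex K -> cube z' (2 * r) `<=` simplex K' ->
  cube z r `&` cube z' r = set0.
Proof.
move=> r0 KT K'T KK' zK zK'; rewrite -subset0 => x [zx z'x].
have [_ card_el _ meet] := conf.
have [cK _] := card_el _ KT; have [cK' _] := card_el _ K'T.
have cJ : (#|K :&: K'| <= d)%N.
  rewrite -ltnS -cK; apply: proper_card; rewrite finset.properEneq finset.subsetIl andbT.
  apply: contra KK' => /eqP/finset.setIidPl sKK'.
  by rewrite eqEcard sKK' cK cK' leqnn.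
have [a [b [nab ab]]] := few_points_hyperplane cJ.
apply: nab; apply: (@affine_cube_eq0 _ _ a x b r r0) => y xy; apply: ab.
rewrite -meet//; split.
  by apply: zK; rewrite (_ : 2 * r = r + r); [exact: cubeS zx _ xy|ring].
by apply: zK'; rewrite (_ : 2 * r = r + r); [exact: cubeS z'x _ xy|ring].
Qed.

Lemma ediam_gt0 K : K \in elements T -> 0 < ediam (simplex K).
Proof.
move=> KT; have [inj card_el _ _] := conf; have [cK _] := card_el _ KT.
have /card_gt1P[i [j [iK jK ij]]] : (1 < #|K|)%N by rewrite cK.
apply: lt_le_trans (enorm_ediam (simplex_vertex iK) (simplex_vertex jK)).
rewrite lt_def sqrtr_ge0 andbT; apply/eqP => e0; move/eqP: ij; apply.
apply: inj; apply/eqP; rewrite -subr_eq0; apply/eqP/rowP => k; rewrite [RHS]mxE.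
apply/eqP; rewrite -normr_le0 -e0; exact: coor_enorm.
Qed.

(** The inradius is a supremum of radii of Euclidean balls, so some ball has
    more than half of it as radius, and a cube of radius [r / d] fits in a
    ball of radius [r]. *)
Lemma element_cube K (sigma : R) : 0 < sigma -> K \in elements T ->
  ediam (simplex K) <= sigma * inradius (simplex K) ->
  exists z, cube z (ediam (simplex K) / (2 * sigma * d%:R)) `<=` simplex K.
Proof.
move=> s0 KT hs; have e0 := ediam_gt0 KT.
have i0 : 0 < inradius (simplex K) by rewrite -(pmulr_rgt0 _ s0); apply: lt_le_trans hs.
(* The supremum of a set without supremum is 0 by convention. *)
have hsup : has_sup [set r | 0 <= r /\ exists c, [set y | enorm (y - c) <= r] `<=` simplex K].
  by apply: contrapT => /sup_out h; move: i0; rewrite /inradius h ltxx.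
have i2 : inradius (simplex K) / 2 < inradius (simplex K) by lra.
have [r [r0 [c cK]] hr] := sup_gt hsup.1 i2.
exists c => y cy; apply: cK => /=; apply: le_trans (enorm_le_sum _) _.
have h k : `|(y - c) 0 k| <= ediam (simplex K) / (2 * sigma * d%:R).
  by rewrite !mxE; exact: cy.
apply: le_trans (ler_sum _ (fun k _ => h k)) _.
rewrite sumr_const card_ord -[leLHS]mulr_natr.
have dR : d%:R != 0 :> R by rewrite pnatr_eq0 -lt0n.
have -> : ediam (simplex K) / (2 * sigma * d%:R) * d%:R = ediam (simplex K) / sigma / 2.
  by field; rewrite dR gt_eqF.
apply/ltW; apply: le_lt_trans hr.
by rewrite ler_pM2r ?invr_gt0// ler_pdivrMr// mulrC.
Qed.

End element_cubes.

(** * Equivalence of the L2 norm and the coefficient norm *)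

Section finite_element_space.
Context {R : realType} (d : nat) (T : mesh R d) (phi : 'I_(nnodes T) -> 'rV[R]_d -> R).
Variable Om : set 'rV[R]_d.
Hypothesis conf : conforming_mesh T.
Hypothesis nb : nodal_basis phi.
Implicit Types (K : {set 'I_(nnodes T)}) (i j : 'I_(nnodes T)).
Notation mu := (lebesgue_rV (R := R) d).
Notation inner := (inner_elements T Om).
Notation dof := 'I_(#|interior_nodes T Om| + #|boundary_nodes T Om|).

Lemma inner_sub K : K \in inner -> K \in elements T.
Proof. by rewrite inE => /andP[]. Qed.

Lemma measurable_Omega_h : measurable (Omega_h T Om).
Proof.
rewrite (_ : Omega_h T Om = \bigcup_(K in [set K | K \in inner]) simplex K).
  apply: fin_bigcup_measurable => [|K /= /inner_sub KT]; first exact: finite_finset.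
  exact: (measurable_simplex nb).
by apply/seteqP; split=> x [K KS Kx]; exists K.
Qed.

Lemma measurable_fun_Omega_h (f : 'rV[R]_d -> R) :
  (forall K, K \in inner -> affine_on (simplex K) f) ->
  measurable_fun (Omega_h T Om) f.
Proof.
move=> fK _ Y mY.
rewrite (_ : _ `&` _ = \bigcup_(K in [set K | K \in inner]) (simplex K `&` f @^-1` Y)).
  apply: fin_bigcup_measurable => [|K /= KS]; first exact: finite_finset.
  have [a [b fab]] := fK K KS.
  rewrite (_ : _ `&` _ = simplex K `&` (fun x => edot a x + b) @^-1` Y).
    apply: (measurable_funTS (measurable_affine a b)) => //; exact: (measurable_simplex nb (inner_sub KS)).
  by apply/seteqP; split=> x [Kx] /=; rewrite fab.
apply/seteqP; split=> [x [[K KS Kx] Yx]|x [K KS [Kx Yx]]]; first by exists K.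
by split=> //; exists K.
Qed.

Lemma dof_node_Omega_h (k : dof) : Omega_h T Om (node (dof_node k)).
Proof.
rewrite /dof_node; case: fintype.split => l.
  by have := enum_valP l; rewrite inE => /asboolP[].
by have := enum_valP l; rewrite inE => /asboolP[].
Qed.

Lemma dof_node_inj : injective (@dof_node R d T Om).
Proof.
move=> k l; rewrite /dof_node.
case: (split_ordP k) => k' ->; case: (split_ordP l) => l' ->; rewrite ?(unsplitK (inl _)) ?(unsplitK (inr _)).
- by move/enum_val_inj ->.
- move=> e; have := enum_valP l'; rewrite -e; have := enum_valP k'.
  by rewrite !inE => -[_ p] [_ q].
- move=> e; have := enum_valP k'; rewrite e; have := enum_valP l'.
  by rewrite !inE => -[_ p] [_ q].
- by move/enum_val_inj ->.
Qed.

(** The interior and the boundary nodes partition the nodes in the polytope. *)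
Lemma sum_dof (g : 'I_(nnodes T) -> R) :
  \sum_(k : dof) g (dof_node k) = \sum_(j : 'I_(nnodes T) | `[< Omega_h T Om (node j) >]) g j.
Proof.
rewrite big_split_ord /dof_node/=.
under eq_bigr do rewrite (unsplitK (inl _)).
under [X in _ + X = _]eq_bigr do rewrite (unsplitK (inr _)).
rewrite -!(big_enum_val g)/= [RHS](bigID (fun j => `[< bd Om (node j) >]))/= addrC.
congr (_ + _); apply: eq_bigl => j; apply/idP/andP.
- by rewrite inE => /asboolP[? ?]; split; [exact/asboolP|apply/negP => /asboolP].
- by move=> [/asboolP ? /negP p]; rewrite inE; apply/asboolP; split=> // q; apply: p; exact/asboolP.
- by rewrite inE => /asboolP[? ?]; split; exact/asboolP.
- by move=> [/asboolP ? /asboolP ?]; rewrite inE; apply/asboolP; split.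
Qed.

Lemma phi_hat_inner K x (k : dof) : K \in inner -> simplex K x ->
  phi_hat phi k x = phi (dof_node k) x.
Proof. by move=> KS Kx; rewrite /phi_hat /patch mem_set//; exists K. Qed.

Lemma phi_hat_affine K (k : dof) : K \in inner -> affine_on (simplex K) (phi_hat phi k).
Proof.
move=> KS; have [a [b ab]] := phi_affine nb (dof_node k) (inner_sub KS).
by exists a, b => x Kx; rewrite (phi_hat_inner _ KS)// ab.
Qed.

Lemma phi_hat_node (k l : dof) : phi_hat phi k (node (dof_node l)) = (k == l)%:R.
Proof.
rewrite /phi_hat /patch mem_set; last exact: dof_node_Omega_h.
by rewrite (phi_node nb) (inj_eq dof_node_inj).
Qed.

Lemma phi_hat_admissible (k : dof) : admissible (Omega_h T Om) (phi_hat phi k).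
Proof.
have phiK K : K \in inner -> affine_on (simplex K) (phi (dof_node k)).
  by move=> KS; apply: (phi_affine nb); exact: inner_sub.
split.
- apply/measurable_restrict => //; first exact: measurable_Omega_h.
  by rewrite setTI; exact: measurable_fun_Omega_h.
- exists (1 + \sum_(j < nnodes T) phi (dof_node k) (node j) ^+ 2) => x.
  have s0 : 0 <= \sum_(j < nnodes T) phi (dof_node k) (node j) ^+ 2.
    by apply: sumr_ge0 => j _; exact: sqr_ge0.
  rewrite /phi_hat /patch; case: ifPn => [|_]; last by rewrite normr0 addr_ge0.
  rewrite inE => -[K KS Kx]; have := affine_on_sqr_le (phiK K KS) Kx.
  set t := phi _ x => ht.
  have : t ^+ 2 <= \sum_(j < nnodes T) phi (dof_node k) (node j) ^+ 2.
    apply: le_trans ht _; rewrite big_mkcond/=; apply: ler_sum => j _.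
    by case: ifP => // _; exact: sqr_ge0.
  rewrite -[t ^+ 2]real_normK ?num_real// => ht2.
  by have := sqr_ge0 (`|t| - 1); rewrite sqrrB; have := sqr_ge0 `|t|; lra.
- by move=> x nx; rewrite /phi_hat /patch memNset.
Qed.

Variable c : dof -> R.
Let u x := \sum_k c k * phi_hat phi k x.

Lemma combination_affine K : K \in inner -> affine_on (simplex K) u.
Proof. by move=> KS; apply: affine_on_sum => k; exact: phi_hat_affine. Qed.

Lemma combination_node (l : dof) : u (node (dof_node l)) = c l.
Proof.
rewrite /u (bigD1 l)//= phi_hat_node eqxx mulr1 big1 ?addr0// => k kl.
by rewrite phi_hat_node (negbTE kl) mulr0.
Qed.

(** The pivot between the two norms: a sum over element-vertex pairs, which is
    local on the elements like the integral, and counts each coefficient as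
    often as there are inner elements around its node. *)
Let nodal_sum := \sum_(K in inner) \sum_(j in K) u (node j) ^+ 2.
Let valence j := #|[set K in inner | j \in K]|%:R : R.

Lemma nodal_sumE :
  nodal_sum = \sum_(j : 'I_(nnodes T) | `[< Omega_h T Om (node j) >]) u (node j) ^+ 2 * valence j.
Proof.
rewrite /nodal_sum (exchange_big_dep predT)//= [RHS]big_mkcond/=.
apply: eq_bigr => j _; rewrite sumr_const.
rewrite /valence (eq_card (B := [set K in inner | j \in K]%SET)); last first.
  by move=> K; rewrite finset.in_set.
case: asboolP => [_|nj]; first by rewrite mulr_natr.
rewrite (_ : [set K in inner | j \in K]%SET = finset.set0) ?cards0//.
apply/finset.setP => K; rewrite finset.in_set0 finset.in_set; apply/negP => /andP[KS jK].
by apply: nj; exists K => //; exact: simplex_vertex.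
Qed.

Lemma sum_sqr_dof : \sum_k c k ^+ 2 = \sum_(j : 'I_(nnodes T) | `[< Omega_h T Om (node j) >]) u (node j) ^+ 2.
Proof.
rewrite -(sum_dof (fun j => u (node j) ^+ 2)); apply: eq_bigr => k _.
by rewrite combination_node.
Qed.

Lemma sum_sqr_le_nodal_sum : \sum_k c k ^+ 2 <= nodal_sum.
Proof.
rewrite sum_sqr_dof nodal_sumE; apply: ler_sum => j /asboolP[K KS Kj].
rewrite ler_peMr ?sqr_ge0// /valence ler1n card_gt0; apply/finset.set0Pn; exists K.
by rewrite finset.in_set KS; exact: (node_in_simplex conf nb (inner_sub KS)).
Qed.

Variable r : R.
Notation h := (mesh_size T).
Hypothesis r_gt0 : 0 < r.
Hypothesis r_le_h : r <= h.
Hypothesis cubes : forall K, K \in elements T -> exists z, cube z (2 * r) `<=` simplex K.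

Let h_gt0 : 0 < h. Proof. exact: lt_le_trans r_le_h. Qed.

Let cube_choice : exists z : {set 'I_(nnodes T)} -> 'rV[R]_d,
  forall K, K \in elements T -> cube (z K) (2 * r) `<=` simplex K.
Proof.
have /choice[z zK] : forall K, exists z, K \in elements T -> cube z (2 * r) `<=` simplex K.
  move=> K; have [/cubes[z zK]|nK] := boolP (K \in elements T); first by exists z.
  by exists 0.
by exists z.
Qed.

(** Packing: the elements around a node contain disjoint cubes of radius [r],
    all within the cube of radius [h] around the node. *)
Lemma valence_le j : valence j <= (h / r) ^+ d.
Proof.
have [z zK] := cube_choice.
have rr : r <= 2 * r by have := r_gt0; lra.
have mc := measurable_cube (node j) h.
have zS K : K \in [set K in inner | j \in K]%SET -> K \in elements T /\ j \in K.
  by rewrite finset.in_set => /andP[/inner_sub].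
have zr K : K \in elements T -> cube (z K) r `<=` simplex K.
  move=> KT x zx; apply: zK => // k; exact: le_trans (zx k) rr.
have := @sum_cubes_le_integral _ d _ [set K in inner | j \in K]%SET z r (fun=> 1)
  \1_(cube (node j) h) (ltW r_gt0).
rewrite integral_indic// setIT [X in (_ <= X)%E]lebesgue_rV_cube ?(ltW h_gt0)// lee_fin sumr_const.
rewrite -/(valence j) !exprMn -mulrA ler_pM2l ?exprn_gt0// => H.
rewrite exprVn ler_pdivlMr ?exprn_gt0// mulrC; apply: H => //.
- move=> K K' /zS[KT _] /zS[K'T _] KK'.
  exact: (element_cubes_disjoint conf r_gt0 KT K'T KK' (zK _ KT) (zK _ K'T)).
- move=> K x /zS[KT jK] /(zr _ KT) Kx; rewrite indicE mem_set//.
  by apply: simplex_in_cube Kx; [exact: KT|exact: simplex_vertex].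
Qed.

Lemma nodal_sum_le_sum_sqr : nodal_sum <= (h / r) ^+ d * \sum_k c k ^+ 2.
Proof.
rewrite nodal_sumE sum_sqr_dof mulr_sumr; apply: ler_sum => j _.
by rewrite mulrC ler_wpM2r ?sqr_ge0// valence_le.
Qed.

Lemma combination_admissible : admissible (Omega_h T Om) u.
Proof. by apply: admissible_sum => k; exact: phi_hat_admissible. Qed.

Lemma integral_sqr_le_nodal_sum : (\int[mu]_x (u x ^+ 2)%:E <= ((2 * h) ^+ d * nodal_sum)%:E)%E.
Proof.
have [mu_ _ uE] := combination_admissible.
apply: (@integral_le_sum_cover _ d _ inner (@simplex R d T)).
- by move=> K /inner_sub; exact: (measurable_simplex nb).
- move=> K /inner_sub KT; have [_ /(_ _ KT)[cK _] _ _] := conf.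
  have /card_gt0P[i iK] : (0 < #|K|)%N by rewrite cK.
  rewrite -(lebesgue_rV_cube (node i) (ltW h_gt0)) le_measure ?inE//.
  + exact: (measurable_simplex nb).
  + exact: measurable_cube.
  + by move=> x; exact: simplex_in_cube (simplex_vertex iK).
- exact: measurable_funX.
- by move=> x; exact: sqr_ge0.
- by move=> K; apply: sumr_ge0 => j _; exact: sqr_ge0.
move=> x ux; have [[K KS Kx]|/uE u0] := pselect (Omega_h T Om x).
  by exists K; split=> //; apply: affine_on_sqr_le => //; exact: combination_affine.
by move: ux; rewrite u0 expr0n eqxx.
Qed.

(** On a subcube of each element, [u^2] is at least a fixed fraction of the
    square of every nodal value, hence of their mean over the [d + 1]
    vertices; the subcubes are disjoint. *)
Lemma nodal_sum_le_integral_sqr :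
  (((r / 2) ^+ d * ((r / (2 * h)) ^+ 2 / d.+1%:R) * nodal_sum)%:E <=
   \int[mu]_x (u x ^+ 2)%:E)%E.
Proof.
have [mu_ _ uE] := combination_admissible.
have [z zK] := cube_choice.
have rr : r <= 2 * r by have := r_gt0; lra.
have zr K : K \in elements T -> cube (z K) r `<=` simplex K.
  move=> KT x zx; apply: zK => // k; exact: le_trans (zx k) rr.
have /choice[p pP] : forall K, exists p, K \in inner -> cube p (r / 4) `<=` cube (z K) r /\
    forall x y, cube p (r / 4) x -> cube (z K) h y -> simplex K y ->
      u y ^+ 2 <= (2 * h / r) ^+ 2 * u x ^+ 2.
  move=> K; have [KS|nK] := boolP (K \in inner); last by exists 0.
  have KT := inner_sub KS; have [a [b ab]] := combination_affine KS.
  have [p [psub hp]] := affine_cube_sqr_le a (z K) b r_gt0 r_le_h.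
  exists p => _; split=> // x y px zy Ky; rewrite (ab y)// (ab x); first exact: hp.
  by apply: zr => //; exact: psub.
have zC K : K \in elements T -> simplex K (z K).
  by move=> KT; apply: zr => //; exact: cube_center (ltW r_gt0).
have := @sum_cubes_le_integral _ d _ inner p (r / 4)
  (fun K => (r / (2 * h)) ^+ 2 / d.+1%:R * \sum_(j in K) u (node j) ^+ 2) (fun x => u x ^+ 2).
rewrite -mulr_sumr -/nodal_sum (_ : 2 * (r / 4) = r / 2); last by lra.
rewrite mulrA; apply.
- by rewrite divr_ge0// ltW.
- move=> K K' KS K'S KK'; have KT := inner_sub KS; have K'T := inner_sub K'S.
  have := element_cubes_disjoint conf r_gt0 KT K'T KK' (zK _ KT) (zK _ K'T).
  rewrite -!subset0 => dis x [px p'x]; apply: (dis x); split.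
    by have [h1 _] := pP K KS; exact: h1.
  by have [h1 _] := pP K' K'S; exact: h1.
- exact: measurable_funX.
- by move=> x; exact: sqr_ge0.
- move=> K; apply: mulr_ge0; last by apply: sumr_ge0 => j _; exact: sqr_ge0.
  by rewrite divr_ge0// sqr_ge0.
move=> K x KS px; have KT := inner_sub KS; have [_ hp] := pP K KS.
have [_ /(_ _ KT)[cK _] _ _] := conf.
have hu j : j \in K -> u (node j) ^+ 2 <= (2 * h / r) ^+ 2 * u x ^+ 2.
  move=> jK; have Kj := simplex_vertex jK.
  exact: (hp x (node j) px (simplex_in_cube KT (zC _ KT) Kj) Kj).
have H : \sum_(j in K) u (node j) ^+ 2 <= (2 * h / r) ^+ 2 * u x ^+ 2 * d.+1%:R.
  apply: (le_trans (ler_sum _ hu)).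
  by rewrite sumr_const cK mulr_natr.
apply: le_trans (ler_wpM2l _ H) _; first by rewrite divr_ge0// sqr_ge0.
rewrite le_eqVlt; apply/orP; left; apply/eqP; field.
by rewrite !gt_eqF//= ?ltr0n.
Qed.

End finite_element_space.

(** * Condition number of a coercive symmetric matrix *)

Section condition_number.
Context {R : realType} (n : nat) (A : 'M[R]_n) (alpha beta : R).
Hypothesis alpha_gt0 : 0 < alpha.
Hypothesis beta_ge0 : 0 <= beta.
Hypothesis A_sym : A^T = A.
Implicit Types x y : 'cV[R]_n.

Let form x y : R := (x^T *m A *m y) 0 0.

Hypothesis coercive : forall x, alpha * enorm x ^+ 2 <= form x x.
Hypothesis bounded : forall x, form x x <= beta * enorm x ^+ 2.

Let dot x y : R := (x^T *m y) 0 0.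

Let enorm_sqr x : enorm x ^+ 2 = dot x x.
Proof.
rewrite /enorm sqr_sqrtr; last first.
  by apply: sumr_ge0 => ? _; apply: sumr_ge0 => ? _; exact: sqr_ge0.
by rewrite /dot mxE; apply: eq_bigr => i _; rewrite big_ord1 !mxE expr2.
Qed.

Let enorm_ge0 x : 0 <= enorm x. Proof. exact: sqrtr_ge0. Qed.

Let dot_ge0 x : 0 <= dot x x. Proof. by rewrite -enorm_sqr sqr_ge0. Qed.

Let formC x y : form x y = form y x.
Proof.
rewrite /form (_ : x^T *m A *m y = (y^T *m A *m x)^T) ?mxE//.
by rewrite !trmx_mul trmxK A_sym mulmxA.
Qed.

Let formE x y : form x y = dot x (A *m y).
Proof. by rewrite /form /dot mulmxA. Qed.

Let formDl x y z : form (x + y) z = form x z + form y z.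
Proof. by rewrite /form linearD/= !mulmxDl mxE. Qed.

Let formZl a x y : form (a *: x) y = a * form x y.
Proof. by rewrite /form linearZ/= -!scalemxAl mxE. Qed.

Let dotC x y : dot x y = dot y x.
Proof. by rewrite /dot !mxE; apply: eq_bigr => i _; rewrite !mxE mulrC. Qed.

Let dotDl x y z : dot (x + y) z = dot x z + dot y z.
Proof. by rewrite /dot linearD/= !mulmxDl mxE. Qed.

Let dotZl a x y : dot (a *: x) y = a * dot x y.
Proof. by rewrite /dot linearZ/= -!scalemxAl mxE. Qed.

Let dot_sqr a x y :
  dot (x + a *: y) (x + a *: y) = dot x x + 2 * a * dot x y + a ^+ 2 * dot y y.
Proof.
rewrite dotDl dotZl 2!(dotC _ (_ + _)) !(dotDl, dotZl) (dotC y x); ring.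
Qed.

Let form_sqr a x y :
  form (x + a *: y) (x + a *: y) = form x x + 2 * a * form x y + a ^+ 2 * form y y.
Proof.
rewrite formDl formZl 2!(formC _ (_ + _)) !(formDl, formZl) (formC y x); ring.
Qed.

Let dot2 a x y : 2 * a * dot x y <= dot x x + a ^+ 2 * dot y y.
Proof. by have := dot_ge0 (x + (- a) *: y); rewrite dot_sqr; lra. Qed.

Lemma coercive_unitmx : A \in unitmx.
Proof.
rewrite -row_free_unit; apply: inj_row_free => v vA.
have := coercive v^T; rewrite /form trmxK vA mul0mx mxE pmulr_rle0//.
move=> v0; have {v0} : enorm v^T = 0.
  by apply/eqP; rewrite -sqrf_eq0 eq_le v0 sqr_ge0.
move/eqP; rewrite sqrtr_eq0 => v0; apply/rowP => i; rewrite mxE.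
apply/eqP; rewrite -sqrf_eq0 eq_le sqr_ge0 andbT; apply: le_trans v0.
rewrite (bigD1 i)//= big_ord1 mxE lerDl.
by apply: sumr_ge0 => ? _; apply: sumr_ge0 => ? _; exact: sqr_ge0.
Qed.

Let enorm0 : enorm (0 : 'cV[R]_n) = 0.
Proof. by rewrite /enorm big1 ?sqrtr0// => i _; rewrite big1// => j _; rewrite mxE expr0n. Qed.

Let spectral_norm_bounds (B : 'M[R]_n) (M : R) :
  (forall x, enorm x <= 1 -> enorm (B *m x) <= M) -> 0 <= spectral_norm B <= M.
Proof.
move=> BM; pose S := [set enorm (B *m x) | x in [set x : 'cV[R]_n | enorm x <= 1]].
have S0 : S 0 by exists 0; rewrite /= ?mulmx0 enorm0.
have SM : ubound S M by move=> _ [x /= x1 <-]; exact: BM.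
by apply/andP; split; [apply: ub_le_sup => //; exists M|apply: ge_sup => //; exists 0].
Qed.

(** Polarisation: if [v] is the unit vector in the direction of [A x], then
    [4 |A x| = form (v + x) (v + x) - form (v - x) (v - x)], where the last
    term is nonnegative and [|v + x|^2 <= 4]. *)
Lemma spectral_norm_sym_le : 0 <= spectral_norm A <= beta.
Proof.
apply: spectral_norm_bounds => x x1; set w := A *m x.
have [->//|w0] := eqVneq (enorm w) 0.
pose v := (enorm w)^-1 *: w.
have vx : form v x = enorm w.
  by rewrite formZl formE -/w -enorm_sqr expr2 mulKf.
have vv : dot v v = 1.
  by rewrite dotZl dotC dotZl -enorm_sqr expr2 mulKf// mulVf.
have xx : dot x x <= 1 by rewrite -enorm_sqr expr_le1.
have p := bounded (v + 1 *: x); have m := coercive (v + (-1) *: x).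
have {}m : 0 <= form (v + (-1) *: x) (v + (-1) *: x).
  by apply: le_trans m; rewrite mulr_ge0 ?sqr_ge0// ltW.
have d2 : dot (v + 1 *: x) (v + 1 *: x) <= 4.
  by have := dot2 1 v x; rewrite dot_sqr; lra.
have {}p : form (v + 1 *: x) (v + 1 *: x) <= beta * 4.
  by apply: le_trans p _; rewrite enorm_sqr ler_wpM2l.
by move: p m; rewrite !form_sqr vx; lra.
Qed.

(** For [A y = x], coercivity gives [alpha |y|^2 <= y.x], and the product
    is split by the arithmetic-geometric mean inequality. *)
Lemma spectral_norm_inv_le : 0 <= spectral_norm (invmx A) <= alpha^-1.
Proof.
apply: spectral_norm_bounds => x x1; set y := invmx A *m x.
have Ay : A *m y = x by rewrite mulmxA mulmxV ?coercive_unitmx// mul1mx.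
have := coercive y; rewrite formE Ay enorm_sqr => h.
have h2 := dot2 alpha^-1 y x.
rewrite -(@ler_pXn2r _ 2)// ?nnegrE ?invr_ge0 ?(ltW alpha_gt0)// enorm_sqr.
have xx : dot x x <= 1 by rewrite -enorm_sqr expr_le1.
have : alpha^-1 * dot y x >= dot y y by rewrite ler_pdivlMl.
have : alpha^-1 ^+ 2 * dot x x <= alpha^-1 ^+ 2 by rewrite ler_piMr// sqr_ge0.
lra.
Qed.

Lemma cond2_le : cond2 A <= beta / alpha.
Proof.
have /andP[? ?] := spectral_norm_sym_le.
by have /andP[? ?] := spectral_norm_inv_le; exact: ler_pM.
Qed.

End condition_number.

(** * Uniform bounds over the family of meshes *)

(** The lower bound is assumed near points of the extended domain only, but the
    kernel is radial: it suffices to realise each short vector [z] as a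
    difference of two such points.  A boundary point [p] and [p + z] will do;
    without boundary points the extended domain is the whole space. *)
Lemma kernel_lower_bound (R : realType) (d : nat) (Om : set 'rV[R]_d) (delta gamma0 : R)
    (gamma : 'rV[R]_d -> 'rV[R]_d -> R) (gammat : R -> R) : 0 < delta ->
  open Om -> (forall x y, gamma x y = gammat (enorm (y - x))) ->
  (forall x, extended_domain Om delta x ->
     forall y, rel_ball Om delta (delta / 2) x y -> gamma0 <= gamma x y) ->
  forall z : 'rV[R]_d, enorm z <= delta / 2 -> gamma0 <= gammat (enorm z).
Proof.
move=> delta0 oOm gE K1 z zd.
suff [p px pz] : exists2 p, extended_domain Om delta p & extended_domain Om delta (p + z).
  have := K1 p px (p + z); rewrite gE addrAC subrr add0r; apply.
  by split=> //; rewrite addrAC subrr add0r.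
have [[p bp]|nb] := pselect (bd Om !=set0).
  have near y : enorm (y - p) < delta -> extended_domain Om delta y.
    move=> yp; have [?|nOy] := pselect (Om y); [by left|right; split=> //].
    apply: le_lt_trans yp; apply: ge_inf; last by exists p.
    by exists 0 => _ [q _ <-]; exact: sqrtr_ge0.
  have e0 : enorm (0 : 'rV[R]_d) = 0.
    by rewrite /enorm big1 ?sqrtr0// => i _; rewrite big1// => j _; rewrite mxE expr0n.
  exists p; apply: near; first by rewrite subrr e0.
  by rewrite addrAC subrr add0r; apply: le_lt_trans zd _; lra.
have all y : extended_domain Om delta y.
  have [?|nOy] := pselect (Om y); [by left|right; split=> //].
  rewrite /setdist (_ : bd Om = set0); last first.
    by apply/seteqP; split=> // p bp; apply: nb; exists p.
  by rewrite image_set0 inf0.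
by exists 0; exact: all.
Qed.

Lemma closure_coor_bounded (R : realType) (d : nat) (Om : set 'rV[R]_d) (M : R) :
  (forall x, Om x -> enorm x <= M) -> closure Om `<=` cube 0 (M + 1).
Proof.
move=> OM x /(_ (ball x 1))[|y [Oy xy] k]; first exact: nbhsx_ballx.
have := xy.2 0 k; rewrite mxE subr0 /ball/= => xyk.
rewrite (_ : x 0 k = y 0 k + (x 0 k - y 0 k)); last by ring.
by rewrite (le_trans (ler_normD _ _))// lerD ?(ltW xyk)// (le_trans (coor_enorm _ _))// OM.
Qed.

Lemma admissibleS (R : realType) (d : nat) (E F : set 'rV[R]_d) u :
  E `<=` F -> admissible E u -> admissible F u.
Proof. by move=> EF [mu_ bu uE]; split=> // x nF; apply: uE => /EF. Qed.

Lemma energyC (R : realType) (d : nat) (k u v : 'rV[R]_d -> R) : energy k u v = energy k v u.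
Proof. by rewrite /energy; congr (_ * _); apply: eq_Rintegral => p _; ring. Qed.

(** The bounds are uniform over a family of meshes as soon as [kappa] is. *)
Lemma mass_equivalence (R : realType) (d : nat) (T : mesh R d)
    (phi : 'I_(nnodes T) -> 'rV[R]_d -> R) (Om : set 'rV[R]_d) (kappa : R) :
  conforming_mesh T -> nodal_basis phi -> (lebesgue_rV d (Omega_h T Om) < +oo)%E -> 0 < kappa -> kappa <= 1 ->
  0 < mesh_size T ->
  (forall K, K \in elements T ->
     exists z, cube z (2 * (kappa * mesh_size T)) `<=` simplex K) ->
  forall c : 'I_(#|interior_nodes T Om| + #|boundary_nodes T Om|) -> R,
  (kappa / 2) ^+ d * ((kappa / 2) ^+ 2 / d.+1%:R) * mesh_size T ^+ d * (\sum_k c k ^+ 2)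
    <= \int[lebesgue_rV d]_x ((\sum_k c k * phi_hat phi k x) ^+ 2) <=
  (2 / kappa) ^+ d * mesh_size T ^+ d * (\sum_k c k ^+ 2).
Proof.
move=> conf nb finO k0 k1 h0 cubes c; set mass := Rintegral _ _ _.
have r0 : 0 < kappa * mesh_size T by rewrite mulr_gt0.
have rh : kappa * mesh_size T <= mesh_size T by rewrite ler_piMl// ltW.
have SW := sum_sqr_le_nodal_sum conf nb c.
have WS := nodal_sum_le_sum_sqr conf nb c r0 rh cubes.
have ad := combination_admissible nb c.
have mO := measurable_Omega_h Om nb.
have up := integral_sqr_le_nodal_sum conf nb c r0 rh.
have lo := nodal_sum_le_integral_sqr conf nb c r0 rh cubes.
rewrite (sqr_integralE mO finO ad) -/mass !lee_fin in up lo.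
apply/andP; split.
  apply: le_trans lo; rewrite -mulrA.
  have -> : kappa * mesh_size T / (2 * mesh_size T) = kappa / 2 by field; rewrite gt_eqF.
  rewrite [kappa * mesh_size T / 2]mulrAC [(_ * mesh_size T) ^+ d]exprMn.
  rewrite [leRHS](_ : _ = (kappa / 2) ^+ d * ((kappa / 2) ^+ 2 / d.+1%:R) * (mesh_size T ^+ d *
    \sum_(K in inner_elements T Om) \sum_(j in K) (\sum_k c k * phi_hat phi k (node j)) ^+ 2)); last by ring.
  apply: ler_wpM2l; last by rewrite ler_wpM2l// exprn_ge0// ltW.
  by rewrite mulr_ge0// ?divr_ge0 ?exprn_ge0 ?divr_ge0// ltW.
apply: le_trans up _.
have -> : (2 / kappa) ^+ d * mesh_size T ^+ d * \sum_k c k ^+ 2 =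
    (2 * mesh_size T) ^+ d * ((mesh_size T / (kappa * mesh_size T)) ^+ d * \sum_k c k ^+ 2).
  by rewrite mulrA -!exprMn; congr (_ ^+ d * _); field; rewrite !gt_eqF.
by rewrite ler_wpM2l// exprn_ge0// mulr_ge0// ltW.
Qed.

Theorem theorem4p5 (R : realType) (d : nat) (hd : (0 < d)%N)
  (Om : set 'rV[R]_d) (hOm : convex_lipschitz_domain Om)
  (delta : R) (hdelta : 0 < delta)
  (gamma : 'rV[R]_d -> 'rV[R]_d -> R) (gammat : R -> R)
  (gamma_ge0 : forall x y, 0 <= gamma x y)
  (gamma_sym : forall x y, gamma x y = gamma y x)
  (hK1 : kernel_K1 Om delta gamma)
  (hK2 : kernel_K2 gamma gammat)
  (gammat_horizon : forall r, delta < r -> gammat r = 0)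
  (I : Type) (Th : I -> mesh R d)
  (hTh : forall i, simultaneous_triangulation (Th i) Om delta)
  (hsr : shape_regular Th) (hqu : quasi_uniform Th)
  (hh0 : forall eps, 0 < eps -> exists i, mesh_size (Th i) < eps)
  (phi : forall i, 'I_(nnodes (Th i)) -> 'rV[R]_d -> R)
  (hphi : forall i, nodal_basis (phi i)) :
  exists C : R, forall i,
    stiffness Om gamma (phi i) \in unitmx /\
    cond2 (stiffness Om gamma (phi i)) <= C.
Proof.
have [_ oOm [M OM] _ _] := hOm.
have [gE gt0 mk k_int] := hK2.
have [gamma0 [g0 K1]] := hK1.
have [sigma s0 hs] := hsr; have [tau t0 ht] := hqu.
pose k (z : 'rV[R]_d) := gammat (enorm z).
have k_ge0 z : 0 <= k z by apply: gt0; exact: sqrtr_ge0.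
have k_even z : k (- z) = k z.
  rewrite /k /enorm; congr (gammat (Num.sqrt _)); apply: eq_bigr => i _.
  by apply: eq_bigr => j _; rewrite mxE sqrrN.
have gk x y : gamma x y = k (y - x) by exact: gE.
have kg z : enorm z <= delta / 2 -> gamma0 <= k z.
  apply: (kernel_lower_bound hdelta oOm gE) => x ex y; exact: (K1 x ex).1.
(* One set containing every polytope, so that the Poincare constant is the same for all meshes. *)
pose F : set 'rV[R]_d := cube 0 (`|M| + 1).
have mF : measurable F by exact: measurable_cube.
have finF : (lebesgue_rV d F < +oo)%E.
  by rewrite lebesgue_rV_cube ?ltry// addr_ge0.
have OF i : Omega_h (Th i) Om `<=` F.
  move=> x [K]; rewrite inE => /andP[_ /asboolP KO] /KO.
  apply: closure_coor_bounded => y /OM; move/le_trans; apply; exact: ler_norm.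
have [cP cP0 poinc] : exists2 c, 0 < c & forall u, admissible F u ->
    c * \int[lebesgue_rV d]_x (u x ^+ 2) <= energy k u u.
  apply: (poincare mk k_ge0 k_even k_int mF finF hd g0 _ kg); first by lra.
  by move=> x j /(_ j); rewrite mxE subr0; apply.
pose kappa := Num.min 1 (tau / (4 * sigma * d%:R)).
have dR : 0 < d%:R :> R by rewrite ltr0n.
have kappa0 : 0 < kappa by rewrite lt_min ltr01 divr_gt0// !mulr_gt0.
have kappa1 : kappa <= 1 by rewrite ge_min lexx.
pose m1 := (kappa / 2) ^+ d * ((kappa / 2) ^+ 2 / d.+1%:R).
pose m2 := (2 / kappa) ^+ d.
have m10 : 0 < m1 by rewrite mulr_gt0 ?divr_gt0 ?exprn_gt0 ?divr_gt0.
have m20 : 0 < m2 by rewrite exprn_gt0// divr_gt0.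
exists (2 * m2 / (cP * m1)) => i.
have [conf _ [inner0 _ _ _]] := hTh i.
set h := mesh_size (Th i).
have h0 : 0 < h.
  have /finset.set0Pn[K KS] := inner0.
  have KT := inner_sub KS.
  exact: lt_le_trans (ediam_gt0 hd conf KT) (ediam_mesh_size KT).
have cubes K : K \in elements (Th i) -> exists z, cube z (2 * (kappa * h)) `<=` simplex K.
  move=> KT; have [z zK] := element_cube hd conf s0 KT (hs i K KT).
  exists z => x zx; apply: zK => j; apply: le_trans (zx j) _.
  apply: le_trans (_ : 2 * (tau / (4 * sigma * d%:R) * h) <= _).
    by rewrite ler_wpM2l// ler_wpM2r ?(ltW h0)// ge_min lexx orbT.
  have -> : 2 * (tau / (4 * sigma * d%:R) * h) = tau * h / (2 * sigma * d%:R).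
    by field; rewrite !gt_eqF.
  by rewrite ler_pM2r ?invr_gt0 ?mulr_gt0//; exact: ht.
have mO := measurable_Omega_h Om (hphi i).
have finO : (lebesgue_rV d (Omega_h (Th i) Om) < +oo)%E.
  by apply: le_lt_trans finF; rewrite le_measure ?inE//; exact: OF.
have mass := mass_equivalence conf (hphi i) finO kappa0 kappa1 h0 cubes.
have adO l := phi_hat_admissible (hphi i) (Om := Om) l.
have adF l := admissibleS (OF i) (adO l).
set A := stiffness _ _ _.
have AE a b : A a b = energy k (phi_hat (phi i) a) (phi_hat (phi i) b).
  by rewrite mxE; exact: (nonlocal_form_energy mk k_ge0 k_even k_int mO finO gk).
pose V := 'cV[R]_(#|interior_nodes (Th i) Om| + #|boundary_nodes (Th i) Om|).
pose c (x : V) l := x l 0.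
have form x : (x^T *m A *m x) 0 0 =
    energy k (fun y => \sum_l c x l * phi_hat (phi i) l y) (fun y => \sum_l c x l * phi_hat (phi i) l y).
  rewrite -(energy_sum mk k_ge0 k_even k_int mF finF _ adF) mxE exchange_big/=.
  apply: eq_bigr => b _; rewrite mxE mulr_suml; apply: eq_bigr => a _.
  by rewrite mxE AE energyC /c; ring.
have norm (x : V) : enorm x ^+ 2 = \sum_l c x l ^+ 2.
  rewrite /enorm sqr_sqrtr; first by apply: eq_bigr => l _; rewrite big_ord1.
  by apply: sumr_ge0 => ? _; apply: sumr_ge0 => ? _; exact: sqr_ge0.
have adu x := admissible_sum (c x) adF.
have Asym : A^T = A by apply/matrixP => a b; rewrite mxE !AE energyC.
pose alpha := cP * (m1 * h ^+ d); pose beta := 2 * (m2 * h ^+ d).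
have hd0 : 0 < h ^+ d by rewrite exprn_gt0.
have alpha0 : 0 < alpha by apply: mulr_gt0 => //; exact: mulr_gt0.
have beta0 : 0 <= beta by apply: mulr_ge0 => //; apply: mulr_ge0; exact: ltW.
have coer (x : V) : alpha * enorm x ^+ 2 <= (x^T *m A *m x) 0 0.
  rewrite form; apply: le_trans (poinc _ (adu x)).
  by rewrite /alpha -mulrA norm ler_pM2l//; have /andP[] := mass (c x).
have bnd (x : V) : (x^T *m A *m x) 0 0 <= beta * enorm x ^+ 2.
  rewrite form; apply: le_trans (energy_le mk k_ge0 k_even k_int mF finF (adu x)) _.
  by rewrite /beta -mulrA norm ler_pM2l//; have /andP[] := mass (c x).
split; first exact: (coercive_unitmx alpha0 coer).
have -> : 2 * m2 / (cP * m1) = beta / alpha.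
  by rewrite /alpha /beta; field; rewrite !gt_eqF.
exact: (cond2_le alpha0 beta0 Asym coer bnd).
Qed.
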